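(* Assume that for every point $(x_0,p_0,p_0')\in U$ the Cauchy problem $u^A_\alpha=F^A_\alpha(x^i,u^B,u^B_\Gamma)$, $u^A(x^\Lambda,x_0^\alpha)=a^A(x^\Lambda)$ is approximately solvable for every initial data at $(x_0,p_0,p_0')$. Let $l\ge k$, let $z_0=((x^i)_0,(p^A)_0,(p^A_i)_0)$ with $((x^i)_0,(p^A)_0,(p^A_\Lambda)_0)\in U$ and $(p^A_\alpha)_0=F^A_\alpha((x^i)_0,(p^B)_0,(p^B_\Lambda)_0)$, and let $E_0\subset T_{z_0}\mathbb{R}^{n+m+nm}$ be an $l$-dimensional integral element of $\mathcal{I}$ having a basis of the form $\frac{\partial}{\partial x^a}+(c^A_a)_0\frac{\partial}{\partial p^A}+(c^A_{aj})_0\frac{\partial}{\partial p^A_j}$, $a=1,\dots,l$. Then every $l$-dimensional integral element $E\subset T_z\mathbb{R}^{n+m+nm}$ of $\mathcal{I}$ with $(z,E)$ sufficiently close to $(z_0,E_0)$ in $X_l$ is Kähler regular.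
   Context: Let $1\le k<n$, $m\ge1$; indices $i,j\in\{1,\dots,n\}$, $\Lambda,\Gamma\in\{1,\dots,k\}$, $\alpha\in\{k+1,\dots,n\}$, $A,B\in\{1,\dots,m\}$, $a,a'\in\{1,\dots,l\}$, $b\in\{l+1,\dots,n\}$; repeated upper/lower indices summed. $F^A_\alpha(x^i,p^B,p^B_\Lambda)$ real-valued real-analytic on open $U\subset\mathbb{R}^n\times\mathbb{R}^m\times\mathbb{R}^{mk}$. Approximate solvability for every initial data at $(x_0,p_0,p_0')$: for every real-analytic $a^A$ near $(x_0^\Lambda)$ with $a^A(x_0^\Gamma)=p^A_0$, $a^A_\Lambda(x_0^\Gamma)=(p_0')^A_\Lambda$, there is a real-analytic $u$ near $x_0$ with $u^A_\alpha-F^A_\alpha(x^i,u^B,u^B_\Gamma)=O(|x-x_0|^2)$ and $u^A(x^1,\dots,x^k,x_0^{k+1},\dots,x_0^n)-a^A(x^\Lambda)=O(|x^\Lambda-x_0^\Lambda|^3)$. On $\mathbb{R}^n\times\mathbb{R}^m\times\mathbb{R}^{nm}$ with coordinates $z=(x^i,p^A,p^A_i)$, $\mathcal{I}$ is the exterior differential system generated by $f^A_\alpha:=p^A_\alpha-F^A_\alpha(x^i,p^B,p^B_\Gamma)$ and $\eta^A:=dp^A-p^A_idx^i$; set $\Omega^A:=dp^A_i\wedge dx^i$. An integral element at $z$ is a linear subspace of $T_z\mathbb{R}^{n+m+nm}$ on which all forms of $\mathcal{I}$ vanish (functions vanish at $z$); for an $l$-dimensional integral element $E$ with basis $e_1,\dots,e_l$,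 $H(E):=\{v:\phi(v,e_1,\dots,e_l)=0$ for all $(l+1)$-forms $\phi\in\mathcal{I}\}$. $X_l$ is the Grassmann bundle of pairs $(z,E)$ with $E$ an $l$-dimensional subspace of $T_z\mathbb{R}^{n+m+nm}$. Near $(z_0,E_0)$, each $(z,E)$ has a unique basis $\tilde e_a=\frac{\partial}{\partial x^a}+c^b_a\frac{\partial}{\partial x^b}+c^A_a\frac{\partial}{\partial p^A}+c^A_{aj}\frac{\partial}{\partial p^A_j}$, and $(z,c^b_a,c^A_a,c^A_{aj})$ are local coordinates on $X_l$. Let $\mathcal{F}$ be the family of real-analytic functions of $(z,E)$ consisting of $f^A_\alpha$, $\eta^A(\tilde e_a)$, $(df^A_\alpha)(\tilde e_a)$, $\Omega^A(\tilde e_a,\tilde e_{a'})$. A point $t_0$ is an ordinary zero of a family $\mathcal{F}$ of germs of real-analytic functions vanishing at $t_0$ if there are $f_1,\dots,f_\kappa\in\mathcal{F}$ with linearly independent differentials at $t_0$ such that the germ at $t_0$ of the common zero set of $\mathcal{F}$ equals that of $\{f_1=\dots=f_\kappa=0\}$. An $l$-dimensional integral element $E$ at $z$ (with $(z,E)$ in this chart) is Kähler ordinary if $(z,E)$ is an ordinary zero of $\mathcal{F}$, and Kähler regular if it is Kähler ordinary and $\dim H(E')$ is constant for all $l$-dimensional integral elements $E'$ at $z'$ with $(z',E')$ sufficiently close to $(z,E)$. *)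

(* Defs.v *)
From HB Require Import structures.
From mathcomp Require Import all_boot all_order all_algebra.
From mathcomp Require Import all_classical all_reals all_analysis.
Set Implicit Arguments. Unset Strict Implicit. Unset Printing Implicit Defensive.
Import Order.TTheory GRing.Theory Num.Theory.
Import numFieldNormedType.Exports.
Local Open Scope classical_set_scope.
Local Open Scope ring_scope.

(* Index types.  Indices are 0-based: x^i, i : 'I_n ;  p^A, A : 'I_m. *)
(*   Lambda-indices  (1..k in the paper)   : {i : 'I_n | i < k}       *)
(*   alpha-indices   (k+1..n in the paper) : {i : 'I_n | k <= i}      *)
(*   a-indices       (1..l in the paper)   : 'I_l  (x^a with a < l)   *)
(*   b-indices       (l+1..n in the paper) : {i : 'I_n | l <= i}      *)
Notation Lidx n k := {i : 'I_n | (i < k)%N}.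
Notation Gidx n k := {i : 'I_n | (k <= i)%N}.
Notation Bidx n l := {i : 'I_n | (l <= i)%N}.

(* coordinates (x^i, p^A, p^A_i) of R^n x R^m x R^{nm} *)
Notation Coord n m := (('I_n + 'I_m) + ('I_m * 'I_n))%type.
(* coordinates (x^i, p^B, p^B_Lambda) of the domain of F *)
Notation FCoord n m k := (('I_n + 'I_m) + ('I_m * Lidx n k))%type.
(* fibre coordinates c^b_a, c^A_a, c^A_{aj} of the chart of X_l *)
Notation ChartC n m l :=
  ((('I_l * Bidx n l) + ('I_l * 'I_m)) + ('I_l * ('I_m * 'I_n)))%type.
(* chart coordinates (z, c) on X_l *)
Notation XCoord n m l := (Coord n m + ChartC n m l)%type.
(* the family F indexes: f^A_alpha, eta^A(e_a), df^A_alpha(e_a), Omega^A(e_a,e_a') *)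
Notation FamIdx n m k l :=
  ((('I_m * Gidx n k) + ('I_m * 'I_l)) +
   ((('I_m * Gidx n k) * 'I_l) + (('I_m * 'I_l) * 'I_l)))%type.

Section Analysis.
Variable R : realType.

Definition dmax (I : finType) (x y : I -> R) : R :=
  \big[Num.max/0]_(i : I) `|x i - y i|.

Definition open_set (I : finType) (V : (I -> R) -> Prop) : Prop :=
  forall y, V y -> exists r : R, 0 < r /\ forall x, dmax x y < r -> V x.

Definition ps_partial (I : finType) (c : (I -> nat) -> R) (y x : I -> R)
    (N : nat) : R :=
  \sum_(al : {ffun I -> 'I_N.+1} | (\sum_(i : I) nat_of_ord (al i) <= N)%N)
     c (fun i => nat_of_ord (al i)) * \prod_(i : I) (x i - y i) ^+ (al i).

Definition ps_abs_partial (I : finType) (c : (I -> nat) -> R) (y x : I -> R)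
    (N : nat) : R :=
  \sum_(al : {ffun I -> 'I_N.+1} | (\sum_(i : I) nat_of_ord (al i) <= N)%N)
     `|c (fun i => nat_of_ord (al i))| * \prod_(i : I) `|x i - y i| ^+ (al i).

Definition analytic_at (I : finType) (V : (I -> R) -> Prop)
    (f : (I -> R) -> R) (y : I -> R) : Prop :=
  exists r : R, 0 < r /\ exists c : (I -> nat) -> R,
    forall x, dmax x y < r ->
      V x /\ (exists M : R, forall N, ps_abs_partial c y x N <= M) /\
      (fun N => ps_partial c y x N) @ \oo --> f x.

Definition real_analytic_on (I : finType) (V : (I -> R) -> Prop)
    (f : (I -> R) -> R) : Prop :=
  open_set V /\ forall y, V y -> analytic_at V f y.

Definition dirderiv (I : finType) (g : (I -> R) -> R) (x v : I -> R) : R :=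
  derive1 (fun t : R => g (fun i => x i + t * v i)) 0.

Definition pderiv (I : finType) (g : (I -> R) -> R) (i : I) (x : I -> R) : R :=
  dirderiv g x (fun j => if j == i then 1 else 0).

Definition lin_indep (I : finType) (d : nat) (w : 'I_d -> I -> R) : Prop :=
  forall lam : 'I_d -> R, (forall s, \sum_(j < d) lam j * w j s = 0) ->
    forall j, lam j = 0.

Definition in_span (I : finType) (d : nat) (w : 'I_d -> I -> R) (v : I -> R)
  : Prop := exists lam : 'I_d -> R, forall s, v s = \sum_(j < d) lam j * w j s.

(* two subsets of R^I have the same dimension (= max. number of linearly
   independent vectors they contain) *)
Definition has_indep (I : finType) (H : (I -> R) -> Prop) (d : nat) : Prop :=
  exists w : 'I_d -> I -> R, (forall j, H (w j)) /\ lin_indep w.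

Definition same_dim (I : finType) (H1 H2 : (I -> R) -> Prop) : Prop :=
  forall d, has_indep H1 d <-> has_indep H2 d.

End Analysis.

Section EDS.
Variables (R : realType) (n m k l : nat).
(* F^A_alpha, meaningful on the open set U *)
Variable F : 'I_m -> Gidx n k -> (FCoord n m k -> R) -> R.

Notation V := (Coord n m -> R).

Definition form (d : nat) := ('I_d -> V) -> R.

Definition upd (d : nat) (vs : 'I_d -> V) (j : 'I_d) (w : V) : 'I_d -> V :=
  fun i => if i == j then w else vs i.

Definition altform (d : nat) (phi : form d) : Prop :=
  (forall (vs : 'I_d -> V) j (a : R) (u w : V),
     phi (upd vs j (fun s => a * u s + w s)) =
     a * phi (upd vs j u) + phi (upd vs j w)) /\
  (forall (vs : 'I_d -> V) (i j : 'I_d), i != j -> vs i = vs j -> phi vs = 0).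

Definition wedge1 (d : nat) (theta : V -> R) (beta : form d) : form d.+1 :=
  fun vs => \sum_(j < d.+1) (-1) ^+ j * theta (vs j) * beta (fun i => vs (lift j i)).

Definition dx (i : 'I_n) (v : V) : R := v (inl (inl i)).
Definition dp (A : 'I_m) (v : V) : R := v (inl (inr A)).
Definition dpp (A : 'I_m) (i : 'I_n) (v : V) : R := v (inr (A, i)).

Definition zx (z : V) (i : 'I_n) : R := z (inl (inl i)).
Definition zp (z : V) (A : 'I_m) : R := z (inl (inr A)).
Definition zpp (z : V) (A : 'I_m) (i : 'I_n) : R := z (inr (A, i)).

Definition Fproj (z : V) : FCoord n m k -> R :=
  fun s => match s with
  | inl (inl i) => zx z i
  | inl (inr B) => zp z B
  | inr (B, G) => zpp z B (val G)
  end.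

Definition fz (A : 'I_m) (al : Gidx n k) (z : V) : R :=
  zpp z A (val al) - F A al (Fproj z).

Definition eta (z : V) (A : 'I_m) (v : V) : R :=
  dp A v - \sum_(i < n) zpp z A i * dx i v.
Definition df (z : V) (A : 'I_m) (al : Gidx n k) (v : V) : R :=
  dirderiv (fz A al) z v.

(* Omega^A = dp^A_i /\ dx^i  (= - d eta^A) *)
Definition Omega (A : 'I_m) (u v : V) : R :=
  \sum_(i < n) (dpp A i u * dx i v - dpp A i v * dx i u).

Definition Omega_wedge (d : nat) (A : 'I_m) (delta : form d) : form d.+2 :=
  fun vs => \sum_(i < n) wedge1 (dpp A i) (wedge1 (dx i) delta) vs.

(* Values at z of the d-forms of the differential ideal I generated by the
   f^A_alpha and eta^A, i.e. of
     g_{A alpha} f^A_alpha + alpha_{A alpha} /\ df^A_alpha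
       + beta_A /\ eta^A + delta_A /\ d eta^A
   with arbitrary coefficient forms. *)
Definition omega_part (z : V) (d : nat) : form d.+1 -> Prop :=
  match d return form d.+1 -> Prop with
  | 0 => fun r => forall vs, r vs = 0
  | d'.+1 => fun r => exists de : 'I_m -> form d',
      (forall A, altform (de A)) /\
      forall vs, r vs = \sum_(A < m) Omega_wedge A (de A) vs
  end.

Definition one_part (z : V) (d : nat) : form d -> Prop :=
  match d return form d -> Prop with
  | 0 => fun r => forall vs, r vs = 0
  | d'.+1 => fun r =>
      exists (al : 'I_m -> Gidx n k -> form d') (be : 'I_m -> form d')
             (om : form d'.+1),
      (forall A a, altform (al A a)) /\ (forall A, altform (be A)) /\
      omega_part z om /\
      forall vs, r vs =
        \sum_(A < m) \sum_(a : Gidx n k) wedge1 (df z A a) (al A a) vs +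
        \sum_(A < m) wedge1 (eta z A) (be A) vs + om vs
  end.

Definition inI (z : V) (d : nat) (phi : form d) : Prop :=
  exists (ga : 'I_m -> Gidx n k -> form d) (r : form d),
    (forall A a, altform (ga A a)) /\ one_part z r /\
    forall vs, phi vs =
      \sum_(A < m) \sum_(a : Gidx n k) fz A a z * ga A a vs + r vs.

(* E = span of the basis e is an l-dimensional integral element at z:
   all forms of I (including the functions f^A_alpha) vanish on E *)
Definition integral_element (z : V) (e : 'I_l -> V) : Prop :=
  lin_indep e /\
  forall (d : nat) (phi : form d), inI z phi ->
    forall vs : 'I_d -> V, (forall j, in_span e (vs j)) -> phi vs = 0.

Definition polar (z : V) (e : 'I_l -> V) : V -> Prop :=
  fun v => forall phi : form l.+1, inI z phi ->
    phi (fun j => match unlift ord0 j with Some i => e i | None => v end) = 0.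

Definition zof (t : XCoord n m l -> R) : V := fun s => t (inl s).

(* e~_a = d/dx^a + c^b_a d/dx^b + c^A_a d/dp^A + c^A_{aj} d/dp^A_j *)
Definition etilde (t : XCoord n m l -> R) (a : 'I_l) : V :=
  fun s => match s with
  | inl (inl i) =>
      if nat_of_ord i == nat_of_ord a then 1 else
      match (insub i : option (Bidx n l)) with
      | Some b => t (inr (inl (inl (a, b))))
      | None => 0
      end
  | inl (inr A) => t (inr (inl (inr (a, A))))
  | inr (A, j) => t (inr (inr (a, (A, j))))
  end.

Definition fam (s : FamIdx n m k l) (t : XCoord n m l -> R) : R :=
  match s with
  | inl (inl (A, al)) => fz A al (zof t)
  | inl (inr (A, a)) => eta (zof t) A (etilde t a)
  | inr (inl ((A, al), a)) => df (zof t) A al (etilde t a)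
  | inr (inr ((A, a), a')) => Omega A (etilde t a) (etilde t a')
  end.

Definition ordinary_zero (t0 : XCoord n m l -> R) : Prop :=
  (forall s, fam s t0 = 0) /\
  exists S : {set FamIdx n m k l},
    (forall lam : FamIdx n m k l -> R,
       (forall tau, \sum_(s in S) lam s * pderiv (fam s) tau t0 = 0) ->
       forall s, s \in S -> lam s = 0) /\
    exists r : R, 0 < r /\ forall t, dmax t t0 < r ->
      ((forall s, fam s t = 0) <-> (forall s, s \in S -> fam s t = 0)).

Definition kahler_ordinary (t : XCoord n m l -> R) : Prop :=
  integral_element (zof t) (etilde t) /\ ordinary_zero t.

Definition kahler_regular (t : XCoord n m l -> R) : Prop :=
  kahler_ordinary t /\
  exists r : R, 0 < r /\ forall t', dmax t' t < r ->
    integral_element (zof t') (etilde t') ->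
    same_dim (polar (zof t') (etilde t')) (polar (zof t) (etilde t)).

End EDS.

Section Cauchy.
Variables (R : realType) (n m k : nat).
Variable F : 'I_m -> Gidx n k -> (FCoord n m k -> R) -> R.

Definition Fpt (x : 'I_n -> R) (p : 'I_m -> R) (q : 'I_m -> Lidx n k -> R)
  : FCoord n m k -> R :=
  fun s => match s with
  | inl (inl i) => x i
  | inl (inr B) => p B
  | inr (B, G) => q B G
  end.

Definition approx_solvable (x0 : 'I_n -> R) (p0 : 'I_m -> R)
    (p0' : 'I_m -> Lidx n k -> R) : Prop :=
  let x0L : Lidx n k -> R := fun L => x0 (val L) in
  forall a : 'I_m -> (Lidx n k -> R) -> R,
    (exists W : (Lidx n k -> R) -> Prop, W x0L /\
       forall A, real_analytic_on W (a A)) ->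
    (forall A, a A x0L = p0 A) ->
    (forall A L, pderiv (a A) L x0L = p0' A L) ->
    exists u : 'I_m -> ('I_n -> R) -> R,
      (exists W : ('I_n -> R) -> Prop, W x0 /\
         forall A, real_analytic_on W (u A)) /\
      (exists (C r : R), 0 < r /\ forall x, dmax x x0 < r ->
         forall A (al : Gidx n k),
           `| pderiv (u A) (val al) x -
              F A al (Fpt x (fun B => u B x)
                          (fun B G => pderiv (u B) (val G) x)) |
           <= C * dmax x x0 ^+ 2) /\
      (exists (C r : R), 0 < r /\ forall y : Lidx n k -> R, dmax y x0L < r ->
         forall A,
           `| u A (fun i => match (insub i : option (Lidx n k)) with
                            | Some L => y L | None => x0 i end)
              - a A y | <= C * dmax y x0L ^+ 3).

End Cauchy.

(* Main.v *)
Require Import Defs.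
From HB Require Import structures.
From mathcomp Require Import all_boot all_order all_algebra.
From mathcomp Require Import all_classical all_reals all_analysis.
From mathcomp Require Import ring lra zify.
Set Implicit Arguments. Unset Strict Implicit. Unset Printing Implicit Defensive.
Import Order.TTheory GRing.Theory Num.Theory.
Import numFieldNormedType.Exports Defs.
Local Open Scope classical_set_scope.
Local Open Scope ring_scope.

(* Let z satisfy f(z) = 0.  Expanding the approximate solutions to second order
   shows that any symmetric array q_{Lambda Gamma} extends to a symmetric q_{ij}
   such that the vectors d/dx^i + p_i d/dp + q_ij d/dp_j span an n-dimensional
   integral element at z.  A vector w_j d/dp_j killed by all df_alpha is
   determined by the w_Lambda; hence, for c^b_a small, it is also determined by
   its contractions with the x-parts of e_1, ..., e_k.  Used twice, this lets one
   choose q so that the n-dimensional integral element contains e_1, ..., e_k,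
   and then each e_a as soon as Omega(e_a, e_Lambda) = 0 for Lambda <= k.
   So the equations f, eta(e_a), df(e_a) and Omega(e_a, e_Lambda) with
   Lambda < a, Lambda <= k, imply all the others; their differentials are
   independent, and H(E) is that n-dimensional integral element, so its
   dimension is n. *)

Lemma sum_if_eq (V : nmodType) (I : finType) (T : Type) (G : I -> T -> V) (x0 x : T) (i : I) :
  (forall j, G j x0 = 0) -> \sum_j G j (if j == i then x else x0) = G i x.
Proof.
by move=> G0; rewrite (bigD1 i) //= eqxx big1 ?addr0 // => j /negbTE ->.
Qed.

Section LinearClosure.
Variables (K : pzRingType) (V : lmodType K).

Definition lin_closed (P : V -> Prop) :=
  P 0 /\ forall a u v, P u -> P v -> P (a *: u + v).

Lemma lin_closedD P u v : lin_closed P -> P u -> P v -> P (u + v).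
Proof. by move=> [_ lP] Pu Pv; rewrite -[u]scale1r; exact: lP. Qed.

Lemma lin_closedZ P a u : lin_closed P -> P u -> P (a *: u).
Proof. by move=> [P0 lP] Pu; rewrite -[_ *: _]addr0; exact: lP. Qed.

Lemma lin_closed_sum (J : finType) (Q : pred J) P (u : J -> V) : lin_closed P ->
  (forall j, Q j -> P (u j)) -> P (\sum_(j | Q j) u j).
Proof.
by move=> lP Pu; elim/big_ind: _ => // [|v w]; [case: lP|exact: lin_closedD].
Qed.

End LinearClosure.

Section DotProduct.
Variables (R : realType) (I : finType).
Implicit Types (u v w h : I -> R) (q : I -> I -> R).

Definition basis_vec (T : eqType) (i : T) : T -> R := fun j => if j == i then 1 else 0.

Lemma basis_vec_inj (T T' : eqType) (f : T -> T') i j : injective f ->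
  basis_vec (f i) (f j) = basis_vec i j.
Proof. by move=> f_inj; rewrite /basis_vec inj_eq. Qed.

Definition dot u v : R := \sum_i u i * v i.

Lemma dotC u v : dot u v = dot v u.
Proof. by apply: eq_bigr => i _; rewrite mulrC. Qed.

Fact dot_is_scalar u : scalar (dot u).
Proof.
move=> a v w; rewrite /dot mulr_sumr -big_split; apply: eq_bigr => i _ /=.
by rewrite mulrDr mulrCA.
Qed.
HB.instance Definition _ u := GRing.isLinear.Build R (I -> R) R *%R (dot u) (dot_is_scalar u).

Lemma dotZDl a u v w : dot (a *: u + v) w = a * dot u w + dot v w.
Proof. by rewrite !(dotC _ w) linearP. Qed.

Lemma dotDl u v w : dot (u + v) w = dot u w + dot v w.
Proof. by rewrite !(dotC _ w) linearD. Qed.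

Lemma dot_basis u i : dot u (basis_vec i) = u i.
Proof.
rewrite /dot (bigD1 i) //= /basis_vec eqxx mulr1 big1 ?addr0 // => j /negbTE ->.
by rewrite mulr0.
Qed.

Definition matvec q v : I -> R := fun i => dot (q i) v.

Fact matvec_is_linear q : linear (matvec q).
Proof. by move=> a u v; apply/funext => i; rewrite /matvec linearP. Qed.
HB.instance Definition _ q :=
  GRing.isLinear.Build R (I -> R) (I -> R) *:%R (matvec q) (matvec_is_linear q).

Lemma matvecZDl a q q' v : matvec (a *: q + q') v = a *: matvec q v + matvec q' v.
Proof. by apply/funext => i; exact: dotZDl. Qed.

Lemma matvecDl q q' v : matvec (q + q') v = matvec q v + matvec q' v.
Proof. by rewrite -[q]scale1r matvecZDl !scale1r. Qed.

Definition symmetric_array q := forall i j, q i j = q j i.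

Lemma dot_matvecC q u v : symmetric_array q -> dot u (matvec q v) = dot v (matvec q u).
Proof.
move=> qs; rewrite /dot /matvec /dot.
under eq_bigr do rewrite mulr_sumr; under [RHS]eq_bigr do rewrite mulr_sumr.
rewrite exchange_big; apply: eq_bigr => i _; apply: eq_bigr => j _.
by rewrite qs; ring.
Qed.

Lemma dot_basis_matvec q i j : dot (basis_vec i) (matvec q (basis_vec j)) = q i j.
Proof. by rewrite dotC dot_basis /matvec dot_basis. Qed.

End DotProduct.
Arguments basis_vec {R T}.

Section MaxDistance.
Variables (R : realType) (I : finType).
Implicit Types (x y z u v : I -> R) (r : R).

Lemma dmax_ge0 x y : 0 <= dmax x y.
Proof.
rewrite /dmax; elim/big_rec: _ => // i s _ hs.
by rewrite le_max hs orbT.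
Qed.

Lemma le_dmax x y i : `|x i - y i| <= dmax x y.
Proof. by rewrite /dmax (bigD1 i) //= le_max lexx. Qed.

Lemma le_dmax0 v i : `|v i| <= dmax v 0.
Proof. by have := le_dmax v 0 i; rewrite subr0. Qed.

Lemma dmax_le x y r : 0 <= r -> (forall i, `|x i - y i| <= r) -> dmax x y <= r.
Proof.
move=> r0 h; rewrite /dmax; elim/big_ind: _ => // s t hs ht.
by rewrite ge_max hs ht.
Qed.

Lemma dmaxxx x : dmax x x = 0.
Proof. by apply/eqP; rewrite eq_le dmax_ge0 andbT dmax_le // => i; rewrite subrr normr0. Qed.

Lemma dmaxC x y : dmax x y = dmax y x.
Proof. by apply: eq_bigr => i _; rewrite distrC. Qed.

Lemma dmax_eq0 x y : dmax x y = 0 -> x = y.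
Proof.
move=> d0; apply: funext => i; apply/eqP; rewrite -subr_eq0 -normr_eq0.
by rewrite eq_le normr_ge0 andbT -d0 le_dmax.
Qed.

Lemma dmax_triangle y x z : dmax x z <= dmax x y + dmax y z.
Proof.
apply: dmax_le; first by rewrite addr_ge0 ?dmax_ge0.
move=> i; rewrite -[x i](subrK (y i)) -addrA.
by apply: le_trans (ler_normD _ _) _; rewrite lerD ?le_dmax.
Qed.

Lemma dmax_line y v (t : R) : dmax (y + t *: v) y <= `|t| * dmax v 0.
Proof.
apply: dmax_le => [|i]; first by rewrite mulr_ge0 ?dmax_ge0.
by rewrite [X in X - _]addrC addrK normrM ler_wpM2l ?le_dmax0.
Qed.

Lemma dot_le u v : `|dot u v| <= (\sum_i `|u i|) * dmax v 0.
Proof.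
rewrite mulr_suml; apply: le_trans (ler_norm_sum _ _ _) _; apply: ler_sum => i _.
by rewrite normrM ler_wpM2l ?le_dmax0.
Qed.

Lemma dot_matvec_le q v :
  `|dot v (matvec q v)| <= (\sum_i \sum_j `|q i j|) * dmax v 0 ^+ 2.
Proof.
rewrite mulr_suml; apply: le_trans (ler_norm_sum _ _ _) _; apply: ler_sum => i _.
by rewrite normrM expr2 mulrA mulrC ler_pM ?dot_le ?le_dmax0.
Qed.

Lemma dmax_sub x y : dmax (x - y) 0 = dmax x y.
Proof. by apply: eq_bigr => i _; rewrite subr0. Qed.

Definition dmax_nbhs y : set_system (I -> R) :=
  [set P | exists2 r, 0 < r & forall x, dmax x y < r -> P x].

Global Instance dmax_nbhs_filter y : Filter (dmax_nbhs y).
Proof.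
split=> [|P Q [r r0 hP] [s s0 hQ]|P Q PQ [r r0 hP]]; first by exists 1.
  exists (Num.min r s) => [|x]; first by rewrite lt_min r0.
  by rewrite lt_min => /andP[/hP Px /hQ Qx].
by exists r => // x /hP /PQ.
Qed.

Lemma near_dmax_lt y r : 0 < r -> \forall x \near dmax_nbhs y, dmax x y < r.
Proof. by exists r. Qed.

Lemma dmax_nbhs_center y (P : set (I -> R)) : dmax_nbhs y P -> P y.
Proof. by move=> [r r0]; apply; rewrite dmaxxx. Qed.

Lemma dmax_nbhs_nbhs y (P : set (I -> R)) :
  dmax_nbhs y P -> \forall x \near dmax_nbhs y, dmax_nbhs x P.
Proof.
move=> [r r0 hP]; exists r => // x xr; exists (r - dmax x y); first by rewrite subr_gt0.
move=> x' x'r; apply: hP; apply: le_lt_trans (dmax_triangle x _ _) _.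
by rewrite -ltrBrDr.
Qed.

Lemma cvg_dmax (T : Type) (G : set_system T) (FG : Filter G) (c : T -> I -> R) y :
  (forall i, c^~ i @ G --> y i) -> c @ G --> dmax_nbhs y.
Proof.
move=> hc P [r r0 hP]; apply: filterS (fun s => hP (c s)) _.
have : \forall s \near G, forall i, `|y i - c s i| <= r / 2.
  by apply: filter_forall => i; move/cvgrPdist_le: (hc i); apply; rewrite divr_gt0.
apply: filterS => s hs; apply: le_lt_trans (_ : _ <= r / 2) _; last by lra.
by apply: dmax_le => [|i]; [rewrite divr_ge0 ?ltW|rewrite distrC].
Qed.

Lemma cvg_dmax_line y v : (fun t : R => y + t *: v) @ (0 : R) --> dmax_nbhs y.
Proof.
apply: cvg_dmax => i; rewrite -[X in _ --> X]addr0 -[X in _ --> _ + X](mul0r (v i)).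
by apply: cvgD; [exact: cvg_cst|apply: cvgM; [exact: cvg_id|exact: cvg_cst]].
Qed.

End MaxDistance.

Section OneVariable.
Variable R : realType.
Implicit Types (f : R -> R) (c d e x C : R).

Lemma mul_le_of_le_div C e x : 0 <= x -> x <= e / (`|C| + 1) -> C * x <= e.
Proof.
move=> x0; rewrite ler_pdivlMr ?ltr_wpDl // => xe; apply: le_trans xe.
by rewrite mulrC ler_wpM2l // ler_wpDr // ler_norm.
Qed.

Lemma is_derive0P f d : is_derive (0 : R) (1 : R) f d <->
  forall e : R, 0 < e -> \forall t \near (0 : R), `|f t - f 0 - t * d| <= e * `|t|.
Proof.
have quotient_error (t : R) : t != 0 ->
    `|d - t^-1 *: (f (t *: 1 + 0) - f 0)| = `|t|^-1 * `|f t - f 0 - t * d|.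
  move=> t0; rewrite -[t *: 1]/(t * 1) mulr1 addr0 -[_ *: _]/(t^-1 * _).
  by rewrite -normfV -normrM distrC; congr `|_|; field.
have bound_iff (e t : R) : t != 0 ->
    (`|d - t^-1 *: (f (t *: 1 + 0) - f 0)| <= e) = (`|f t - f 0 - t * d| <= e * `|t|).
  by move=> t0; rewrite quotient_error // ler_pdivrMl ?normr_gt0 // [`|t| * e]mulrC.
have small_iff (e : R) : (\forall t \near 0^', `|d - t^-1 *: (f (t *: 1 + 0) - f 0)| <= e) <->
    \forall t \near (0 : R), `|f t - f 0 - t * d| <= e * `|t|.
  rewrite near_withinE; split; apply: filterS => t h.
    have [->|t0] := eqVneq t 0; last by rewrite -bound_iff //; exact: h.
    by rewrite subrr mul0r subrr !normr0 mulr0.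
  by move=> t0; rewrite bound_iff.
split=> [[df fd] e e0|h].
  by apply/small_iff; rewrite -fd; move/cvgrPdist_le: df; exact.
have cvg_d : t^-1 *: (f (t *: 1 + 0) - f 0) @[t --> 0^'] --> d.
  by apply/cvgrPdist_le => e e0; apply/small_iff; exact: h.
by apply: DeriveDef; [exact: cvgP cvg_d|exact: cvg_lim cvg_d].
Qed.

Lemma is_derive0_of_quadratic_error f C :
  (\forall t \near (0 : R), `|f t| <= C * t ^+ 2) -> is_derive (0 : R) (1 : R) f 0.
Proof.
move=> hf; apply/is_derive0P => e e0.
have f0 : f 0 = 0.
  by have := nbhs_singleton hf; rewrite expr0n mulr0 normr_le0 => /eqP.
have eC : 0 < e / (`|C| + 1) by rewrite divr_gt0 // ltr_wpDl.
near=> t.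
rewrite f0 mulr0 !subr0; apply: le_trans (_ : C * t ^+ 2 <= _); first by near: t.
rewrite -real_normK ?num_real // expr2 mulrA ler_wpM2r //.
by apply: mul_le_of_le_div => //; near: t; exact: (nbhs0_le eC).
Unshelve. all: by end_near. Qed.

Lemma eq0_of_linear_bound c C : (\forall t \near (0 : R)^', `|c| <= C * `|t|) -> c = 0.
Proof.
move=> hc; apply/eqP; rewrite -normr_le0; apply/ler_addgt0Pr => e e0; rewrite add0r.
have eC : 0 < e / (`|C| + 1) by rewrite divr_gt0 // ltr_wpDl.
near (0 : R)^' => t.
apply: le_trans (_ : C * `|t| <= _); first by near: t.
by apply: mul_le_of_le_div => //; near: t; exact: (dnbhs0_le eC).
Unshelve. all: by end_near. Qed.

Lemma quadratic_poly_eq0 c0 c1 c2 C :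
  (\forall t \near (0 : R), `|c0 + t * c1 + t ^+ 2 * c2| <= C * `|t| ^+ 3) ->
  [/\ c0 = 0, c1 = 0 & c2 = 0].
Proof.
move=> hc.
have c00 : c0 = 0.
  have := nbhs_singleton hc.
  by rewrite normr0 !expr0n !mul0r !addr0 mulr0 normr_le0 => /eqP.
have c10 : c1 = 0.
  apply: (eq0_of_linear_bound (C := `|C| + `|c2|)); near=> t.
  have t0 : 0 < `|t| by rewrite normr_gt0; near: t; exact: nbhs_dnbhs_neq.
  have t1 : `|t| <= 1 by near: t; exact: dnbhs0_le.
  have : `|c0 + t * c1 + t ^+ 2 * c2| <= C * `|t| ^+ 3 by near: t; exact: nbhs_dnbhs.
  rewrite c00 add0r => ht; rewrite -(ler_pM2l t0) -normrM.
  have -> : t * c1 = (t * c1 + t ^+ 2 * c2) - t ^+ 2 * c2 by rewrite addrK.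
  apply: le_trans (ler_normB _ _) _; rewrite mulrA mulrDr mulrDl; apply: lerD.
    apply: le_trans ht _; apply: le_trans (_ : `|C| * `|t| ^+ 3 <= _).
      by rewrite ler_wpM2r ?exprn_ge0 // ler_norm.
    by rewrite exprS mulrCA mulrA expr2 mulrA ler_wpM2r // ler_piMr ?mulr_ge0.
  by rewrite normrM normrX expr2 mulrAC.
split=> //; apply: (eq0_of_linear_bound (C := C)); near=> t.
have t0 : 0 < `|t| by rewrite normr_gt0; near: t; exact: nbhs_dnbhs_neq.
have : `|c0 + t * c1 + t ^+ 2 * c2| <= C * `|t| ^+ 3 by near: t; exact: nbhs_dnbhs.
rewrite c00 c10 mulr0 !add0r normrM normrX => ht.
by rewrite -(ler_pM2l (exprn_gt0 2 t0)) mulrCA -exprSr.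
Unshelve. all: by end_near. Qed.

End OneVariable.

Section Gradients.
Variables (R : realType) (I : finType).
Implicit Types (x y h v l : I -> R) (f g : (I -> R) -> R).

Lemma pderiv_affine f i y (d : R) :
  (forall e : R, f (y + e *: basis_vec i) = e * d + f y) -> pderiv f i y = d.
Proof.
move=> f_affine; rewrite /pderiv /dirderiv derive1E.
suff [_ <-] : is_derive (0 : R) (1 : R) (fun e : R => f (y + e *: basis_vec i)) d by [].
apply/is_derive0P => e e0; apply: filterE => h /=.
by rewrite !f_affine mul0r add0r addrK subrr normr0 mulr_ge0 // ltW.
Qed.

Definition has_gradient f y l := forall e, 0 < e ->
  \forall x \near dmax_nbhs y, `|f x - f y - dot l (x - y)| <= e * dmax x y.

Lemma has_gradient_curve f (c : R -> I -> R) l w : has_gradient f (c 0) l ->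
  (forall i, is_derive (0 : R) (1 : R) (c^~ i) (w i)) ->
  is_derive (0 : R) (1 : R) (fun t => f (c t)) (dot l w).
Proof.
move=> hf hc; apply/is_derive0P => e e0.
set B := dmax w 0; set L := \sum_i `|l i|.
have B0 : 0 < B + 1 by rewrite ltr_wpDl ?dmax_ge0.
have L0 : 0 < L + 1 by rewrite ltr_wpDl ?sumr_ge0.
pose e1 := Num.min 1 (e / 2 / (L + 1)).
have e1_gt0 : 0 < e1 by rewrite lt_min ltr01 !divr_gt0.
have c_cvg : c @ (0 : R) --> dmax_nbhs (c 0).
  apply: cvg_dmax => i.
  by apply: differentiable_continuous; apply/derivable1_diffP; case: (hc i).
have c_error : \forall t \near (0 : R), forall i, `|c t i - c 0 i - t * w i| <= e1 * `|t|.
  by apply: (@filter_forall _ _ _ (nbhs (0 : R))) => i; have /is_derive0P /(_ _ e1_gt0) := hc i.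
have e2_gt0 : 0 < e / 2 / (B + 1) by rewrite !divr_gt0.
apply: filterS2 c_error (c_cvg _ (hf _ e2_gt0)) => t ct ft.
have dct : dmax (c t) (c 0) <= (B + 1) * `|t|.
  apply: dmax_le => [|i]; first by rewrite mulr_ge0 // ltW.
  rewrite -[c t i - c 0 i](subrK (t * w i)) addrC mulrDl.
  apply: le_trans (ler_normD _ _) _; rewrite lerD //.
    by rewrite normrM mulrC ler_wpM2r ?le_dmax0.
  by apply: le_trans (ct i) _; rewrite ler_wpM2r // ge_min lexx.
have -> : f (c t) - f (c 0) - t * dot l w =
    (f (c t) - f (c 0) - dot l (c t - c 0)) + dot l (c t - c 0 - t *: w).
  by rewrite !(linearB (dot _)) (scalarZ (dot _)) /=; ring.
rewrite [e]splitr mulrDl; apply: le_trans (ler_normD _ _) _; apply: lerD.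
  apply: le_trans ft _; apply: le_trans (ler_wpM2l (ltW e2_gt0) dct) _.
  by rewrite mulrA divfK ?gt_eqF.
apply: le_trans (dot_le _ _) _; apply: le_trans (_ : (L + 1) * (e1 * `|t|) <= _).
  apply: ler_pM; rewrite ?sumr_ge0 ?dmax_ge0 ?lerDl //.
  by apply: dmax_le => [|i]; [rewrite mulr_ge0 // ltW|rewrite subr0; exact: ct].
rewrite mulrA ler_wpM2r // mulrC -ler_pdivlMr // ge_min lexx orbT //.
Qed.

Lemma is_derive_line y v i : is_derive (0 : R) (1 : R) (fun t : R => (y + t *: v) i) (v i).
Proof.
apply/is_derive0P => e e0; apply: filterE => t /=.
by rewrite !fctE scale0r addr0 [y i + _]addrC addrK subrr normr0 mulr_ge0 // ltW.
Qed.

Lemma has_gradient_line f y l v : has_gradient f y l ->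
  is_derive (0 : R) (1 : R) (fun t => f (y + t *: v)) (dot l v).
Proof.
move=> hf; apply: has_gradient_curve => [|i]; last exact: is_derive_line.
by rewrite scale0r addr0.
Qed.

Lemma has_gradient_dirderiv f y l v : has_gradient f y l -> dirderiv f y v = dot l v.
Proof. by move=> /(has_gradient_line v) hf; rewrite /dirderiv derive1E derive_val. Qed.

Definition grad f y : I -> R := fun i => pderiv f i y.

Lemma has_gradient_grad f y l : has_gradient f y l -> grad f y = l.
Proof.
move=> hf; apply/funext => i.
by rewrite /grad /pderiv (has_gradient_dirderiv _ hf) (dot_basis l i).
Qed.

Lemma has_gradient_of_quadratic_error f y l C :
  (\forall x \near dmax_nbhs y, dmax x y != 0 ->
    `|f x - f y - dot l (x - y)| <= C * dmax x y ^+ 2) ->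
  has_gradient f y l.
Proof.
move=> hf e e0.
have eC : 0 < e / (`|C| + 1) by rewrite divr_gt0 // ltr_wpDl.
apply: filterS2 hf (near_dmax_lt y eC) => x.
have [/dmax_eq0 -> _ _|_ /(_ isT) fx dx] := eqVneq (dmax x y) 0.
  by rewrite !subrr linear0 subrr normr0 dmaxxx mulr0.
apply: le_trans fx _; rewrite expr2 mulrA ler_wpM2r ?dmax_ge0 //.
by rewrite mul_le_of_le_div ?dmax_ge0 // ltW.
Qed.

Lemma has_gradientD f g y l l' : has_gradient f y l -> has_gradient g y l' ->
  has_gradient (fun x => f x + g x) y (l + l').
Proof.
move=> hf hg e e0; have e2_gt0 : 0 < e / 2 by rewrite divr_gt0.
apply: filterS2 (hf _ e2_gt0) (hg _ e2_gt0) => x fx gx.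
have -> : f x + g x - (f y + g y) - dot (l + l') (x - y) =
    (f x - f y - dot l (x - y)) + (g x - g y - dot l' (x - y)).
  by rewrite dotDl; ring.
by rewrite [e]splitr mulrDl; apply: le_trans (ler_normD _ _) _; rewrite lerD.
Qed.

Lemma has_gradientN f y l : has_gradient f y l -> has_gradient (fun x => - f x) y (- l).
Proof.
move=> hf e e0; apply: filterS (hf e e0) => x fx.
have -> : - f x - - f y - dot (- l) (x - y) = - (f x - f y - dot l (x - y)).
  by rewrite ![dot _ (x - y)]dotC (linearN (dot _)) /=; ring.
by rewrite normrN.
Qed.

Lemma dmax_basis_vec (i : I) : dmax (basis_vec i : I -> R) 0 <= 1.
Proof.
apply: dmax_le => // j; rewrite subr0 /basis_vec.
by case: eqP => _; rewrite ?normr1 ?normr0.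
Qed.

Lemma has_gradient_le f y l C : 0 <= C ->
  (\forall x \near dmax_nbhs y, `|f x - f y| <= C * dmax x y) ->
  has_gradient f y l -> forall i, `|l i| <= C.
Proof.
move=> C0 lip hf i; apply/ler_addgt0Pr => e e0.
pose yt (t : R) := y + t *: basis_vec i.
have yt_cvg : yt @ (0 : R) --> dmax_nbhs y by exact: cvg_dmax_line.
near (0 : R)^' => t.
have t0 : t != 0 by near: t; exact: nbhs_dnbhs_neq.
have ft : `|f (yt t) - f y| <= C * dmax (yt t) y.
  by near: t; apply: nbhs_dnbhs; exact: yt_cvg _ lip.
have et : `|f (yt t) - f y - dot l (yt t - y)| <= e * dmax (yt t) y.
  by near: t; apply: nbhs_dnbhs; exact: yt_cvg _ (hf e e0).
have dt : dmax (yt t) y <= `|t|.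
  by apply: le_trans (dmax_line _ _ _) _; rewrite ler_piMr ?dmax_basis_vec.
have t_gt0 : 0 < `|t| by rewrite normr_gt0.
rewrite -(ler_pM2r t_gt0) mulrDl -normrM.
have -> : l i * t = (f (yt t) - f y) - (f (yt t) - f y - dot l (yt t - y)).
  by rewrite /yt [y + _]addrC addrK (scalarZ (dot _)) /= dot_basis; ring.
apply: le_trans (ler_normB _ _) (lerD (le_trans ft _) (le_trans et _)).
  by rewrite ler_wpM2l.
by rewrite ler_wpM2l // ltW.
Unshelve. all: by end_near. Qed.

Lemma has_gradient_locally_bounded f y l : has_gradient f y l ->
  exists C, \forall x \near dmax_nbhs y, `|f x| <= C.
Proof.
move=> hf; exists (`|f y| + (\sum_i `|l i| + 1)).
apply: filterS2 (hf 1 ltr01) (near_dmax_lt y ltr01) => x fx /ltW dx.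
have -> : f x = f y + (dot l (x - y) + (f x - f y - dot l (x - y))) by ring.
apply: le_trans (ler_normD _ _) _; rewrite lerD2l.
apply: le_trans (ler_normD _ _) _; apply: lerD; last by rewrite mul1r in fx; exact: le_trans fx dx.
by apply: le_trans (dot_le _ _) _; rewrite dmax_sub ler_piMr ?sumr_ge0.
Qed.

End Gradients.

Section QuadraticFunctions.
Variables (R : realType) (I : finType).
Implicit Types (a c t : R) (h l v x y : I -> R) (q : I -> I -> R) (f : (I -> R) -> R).

Definition quad a l q h : R := a + dot l h + 2^-1 * dot h (matvec q h).

Lemma quad0 a l q : quad a l q 0 = a.
Proof. by rewrite /quad !linear0 mulr0 !addr0. Qed.

Lemma quadZ a l q t v :
  quad a l q (t *: v) = a + t * dot l v + t ^+ 2 * (2^-1 * dot v (matvec q v)).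
Proof.
rewrite /quad (linearZZ (matvec q)) (scalarZ (dot l)) (scalarZ (dot (t *: v))) /=.
by rewrite [dot (t *: v) _]dotC (scalarZ (dot _)) /= [dot (matvec q v) v]dotC; ring.
Qed.

Lemma quadD a l q h v : symmetric_array q ->
  quad a l q (h + v) =
  quad a l q h + dot (l + matvec q h) v + 2^-1 * dot v (matvec q v).
Proof.
move=> qs; rewrite /quad !dotDl (linearD (matvec q)) !(linearD (dot _)) /=.
by rewrite [dot (matvec q h) v]dotC [dot h (matvec q v)]dot_matvecC //; field.
Qed.

Lemma quad_lin c a a' l l' q q' h :
  quad (c * a + a') (c *: l + l') (c *: q + q') h = c * quad a l q h + quad a' l' q' h.
Proof.
by rewrite /quad matvecZDl dotZDl (linearD (dot h)) (scalarZ (dot h)) /=; ring.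
Qed.

Lemma has_gradient_quad a l q y x : symmetric_array q ->
  has_gradient (fun x => quad a l q (x - y)) x (l + matvec q (x - y)).
Proof.
move=> qs; apply: (has_gradient_of_quadratic_error (C := 2^-1 * \sum_i \sum_j `|q i j|)).
apply: filterE => x' _.
have -> : x' - y = (x - y) + (x' - x) by rewrite [RHS]addrC addrA subrK.
rewrite quadD //; set b := dot (x' - x) (matvec q (x' - x)).
rewrite [X in `|X|](_ : _ = 2^-1 * b); last by ring.
rewrite normrM ger0_norm ?invr_ge0 // -mulrA ler_wpM2l ?invr_ge0 // -dmax_sub.
exact: dot_matvec_le.
Qed.

Lemma quad_inj_cubic_error a a' l l' q q' C :
  symmetric_array q -> symmetric_array q' ->
  (\forall h \near dmax_nbhs 0, `|quad a l q h - quad a' l' q' h| <= C * dmax h 0 ^+ 3) ->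
  [/\ a = a', l = l' & q = q'].
Proof.
move=> qs qs' hquad.
pose da := -1 * a' + a; pose dl := -1 *: l' + l; pose dq := -1 *: q' + q.
have coef0 v : [/\ da = 0, dot dl v = 0 & 2^-1 * dot v (matvec dq v) = 0].
  apply: (quadratic_poly_eq0 (C := `|C| * dmax v 0 ^+ 3)).
  have scale_cvg : (fun t : R => t *: v) @ (0 : R) --> dmax_nbhs 0.
    have -> : (fun t : R => t *: v) = (fun t => 0 + t *: v) by apply/funext => t; rewrite add0r.
    exact: cvg_dmax_line.
  near=> t.
  have ht : `|quad a l q (t *: v) - quad a' l' q' (t *: v)| <= C * dmax (t *: v) 0 ^+ 3.
    by near: t; exact: scale_cvg _ hquad.
  rewrite -quadZ quad_lin mulN1r addrC; apply: le_trans ht _.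
  have := dmax_line 0 v t; rewrite add0r => dt.
  rewrite mulrAC -mulrA -exprMn; apply: le_trans (_ : `|C| * dmax (t *: v) 0 ^+ 3 <= _).
    by rewrite ler_wpM2r ?exprn_ge0 ?dmax_ge0 // ler_norm.
  by rewrite ler_wpM2l // lerXn2r // nnegrE ?dmax_ge0 // mulr_ge0 ?dmax_ge0.
have dq_diag v : dot v (matvec dq v) = 0.
  by have [_ _ /eqP] := coef0 v; rewrite mulf_eq0 invr_eq0 pnatr_eq0 /= => /eqP.
have dqs : symmetric_array dq by move=> i j; rewrite /dq !fctE qs qs'.
split; first by have [/eqP + _ _] := coef0 0; rewrite /da mulN1r addrC subr_eq0 => /eqP.
  apply/funext => i; have [_ + _] := coef0 (basis_vec i); rewrite dot_basis /dl scaleN1r.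
  by rewrite !fctE addrC => /eqP; rewrite subr_eq0 => /eqP.
apply/funext => i; apply/funext => j.
have : dq i j = 0.
  have := dq_diag (basis_vec i + basis_vec j).
  rewrite (linearD (matvec _)) !(linearD (dot _)) /= !dotDl !dq_diag.
  by rewrite !dot_basis_matvec add0r addr0 (dqs j i); lra.
by rewrite /dq scaleN1r !fctE addrC => /eqP; rewrite subr_eq0 => /eqP.
Unshelve. all: by end_near. Qed.

Definition is_quad f := exists a l q, symmetric_array q /\ f =1 quad a l q.

Lemma quad_affine a l h : quad a l 0 h = a + dot l h.
Proof.
rewrite /quad /dot [X in _ + _ * X]big1 ?mulr0 ?addr0 // => i _.
by rewrite /matvec dotC linear0 mulr0.
Qed.

Lemma is_quad_affine a l : is_quad (fun h => a + dot l h).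
Proof. by exists a, l, 0; split=> // h; rewrite quad_affine. Qed.

Lemma is_quad_lin_closed : lin_closed is_quad.
Proof.
split=> [|c f g [a [l [q [qs fE]]]] [a' [l' [q' [qs' gE]]]]].
  by exists 0, 0, 0; split=> // h; rewrite quad_affine dotC linear0 addr0.
exists (c * a + a'), (c *: l + l'), (c *: q + q').
split=> [i j|h]; last by rewrite quad_lin -fE -gE.
by rewrite !fctE qs qs'.
Qed.

Lemma is_quad_coord2 i j : is_quad (fun h => h i * h j).
Proof.
pose q s s' : R := basis_vec i s * basis_vec j s' + basis_vec j s * basis_vec i s'.
exists 0, 0, q; split=> [s s'|h]; first by rewrite /q; ring.
have -> : quad 0 0 q h = 2^-1 * dot h (matvec q h).
  by rewrite /quad dotC linear0 !add0r.
have -> : matvec q h = h j *: basis_vec i + h i *: basis_vec j.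
  apply/funext => s; rewrite /matvec -[q s]/(basis_vec i s *: basis_vec j + _ *: basis_vec i).
  rewrite dotZDl ![dot _ h]dotC (scalarZ (dot _)) /= !dot_basis.
  by rewrite -[RHS]/(h j * basis_vec i s + h i * basis_vec j s); ring.
by rewrite (linearD (dot h)) !(scalarZ (dot h)) /= !dot_basis; field.
Qed.

End QuadraticFunctions.

Section Monomials.
Variables (R : realType) (I : finType).
Implicit Types (al b : I -> nat) (h g : I -> R).

Definition degree al : nat := \sum_i al i.

Definition monomial al h : R := \prod_i h i ^+ al i.

Lemma monomial_cases al : degree al = 0%N /\ (forall h, monomial al h = 1) \/
  exists i b, degree al = (degree b).+1 /\ forall h, monomial al h = h i * monomial b h.
Proof.
have [i ai|a0] := pickP (fun i => (0 < al i)%N); last first.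
  have {}a0 i : al i = 0%N by have := a0 i; case: (al i).
  by left; split=> [|h]; rewrite /degree /monomial big1 // => i _; rewrite a0.
right; exists i, (fun j => al j - (j == i))%N; split=> [|h].
  rewrite /degree (bigD1 i) //= [in RHS](bigD1 i) //= eqxx subn1 -addSn prednK //.
  by congr addn; apply: eq_bigr => j /negbTE ->; rewrite subn0.
rewrite /monomial (bigD1 i) //= [in RHS](bigD1 i) //= mulrA eqxx subn1.
by rewrite -exprS prednK //; congr (_ * _); apply: eq_bigr => j /negbTE ->; rewrite subn0.
Qed.

Lemma monomialD al b h : monomial (fun i => al i + b i)%N h = monomial al h * monomial b h.
Proof. by rewrite -big_split; apply: eq_bigr => i _; rewrite exprD. Qed.

Lemma monomial_coord i h : monomial (fun j => (j == i) : nat) h = h i.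
Proof.
rewrite /monomial (bigD1 i) //= eqxx expr1 big1 ?mulr1 // => j /negbTE ->.
by rewrite expr0.
Qed.

Lemma is_quad_monomial al : (degree al <= 2)%N -> is_quad (monomial al).
Proof.
case: (monomial_cases al) => [[_ al1] _|[i [b [-> alE]]]].
  have -> : monomial al = (fun h => 1 + dot 0 h).
    by apply/funext => h; rewrite al1 dotC linear0 addr0.
  exact: is_quad_affine.
case: (monomial_cases b) => [[_ b1] _|[j [c [-> bE]]]].
  have -> : monomial al = (fun h => 0 + dot (basis_vec i) h).
    by apply/funext => h; rewrite alE b1 dotC dot_basis mulr1 add0r.
  exact: is_quad_affine.
case: (monomial_cases c) => [[_ c1] _|[s [d [-> _]]]] //.
have -> : monomial al = (fun h => h i * h j) by apply/funext => h; rewrite alE bE c1 mulr1.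
exact: is_quad_coord2.
Qed.

Lemma monomial_le (e : R) h al : (forall i, `|h i| <= e) -> `|monomial al h| <= e ^+ degree al.
Proof.
move=> he; rewrite normr_prod -prodrXr; apply: ler_prod => i _.
by rewrite normr_ge0 normrX lerXn2r // nnegrE // (le_trans _ (he i)).
Qed.

Lemma monomial_sub_le (e s : R) h g al :
  (forall i, `|h i| <= e) -> (forall i, `|g i| <= e) -> (forall i, `|h i - g i| <= s) ->
  `|monomial al h - monomial al g| <= (degree al)%:R * e ^+ (degree al).-1 * s.
Proof.
move=> he ge hg; have [d] := ubnP (degree al); elim: d al => // d IH al.
case: (monomial_cases al) => [[-> al1] _|[i [b [-> alE]]] /(IH b) {}IH /=].
  by rewrite !al1 subrr normr0 !mul0r.
have e0 : 0 <= e := le_trans (normr_ge0 _) (he i).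
have s0 : 0 <= s := le_trans (normr_ge0 _) (hg i).
have -> : monomial al h - monomial al g =
    h i * (monomial b h - monomial b g) + (h i - g i) * monomial b g by rewrite !alE; ring.
apply: le_trans (ler_normD _ _) _; rewrite !normrM -natr1 mulrDl mulrDl mul1r; apply: lerD.
  apply: le_trans (_ : e * ((degree b)%:R * e ^+ (degree b).-1 * s) <= _).
    by rewrite ler_pM.
  rewrite !mulrA ler_wpM2r //.
  by case: (degree b) => [|d']; rewrite ?mulr0 ?mul0r // exprS /= mulrA [e * _]mulrC.
by rewrite [leRHS]mulrC ler_pM // monomial_le.
Qed.

Lemma monomial_sub_le_tail (rho e s : R) h g al : 0 < rho -> e <= rho / 2 ->
  (forall i, `|h i| <= e) -> (forall i, `|g i| <= e) -> (forall i, `|h i - g i| <= s) ->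
  (2 < degree al)%N ->
  `|monomial al h - monomial al g| <= 3 / rho ^+ 3 * e ^+ 2 * s * rho ^+ degree al.
Proof.
move=> r0 er he ge hg al3; apply: le_trans (monomial_sub_le al he ge hg) _.
case: (monomial_cases al) => [[al0 _]|[i _]]; first by rewrite al0 in al3.
have e0 : 0 <= e := le_trans (normr_ge0 _) (he i).
have s0 : 0 <= s := le_trans (normr_ge0 _) (hg i).
have [d ->] : exists d, degree al = d.+3 by exists (degree al - 3)%N; lia.
have -> : 3 / rho ^+ 3 * e ^+ 2 * s * rho ^+ d.+3 = 3 * rho ^+ d * e ^+ 2 * s.
  by rewrite !exprS; field; rewrite gt_eqF.
have -> : e ^+ d.+2 = e ^+ d * e ^+ 2 by rewrite -exprD addn2.
rewrite ler_wpM2r //= mulrA ler_wpM2r ?exprn_ge0 //.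
apply: le_trans (_ : d.+3%:R * (rho / 2) ^+ d <= _).
  by rewrite ler_wpM2l // lerXn2r // nnegrE divr_ge0 // ltW.
rewrite exprMn exprVn mulrA ler_pdivrMr ?exprn_gt0 // mulrAC ler_wpM2r ?exprn_ge0 ?(ltW r0) //.
have : (d.+3 <= 3 * 2 ^ d)%N by elim: d => // d; rewrite expnS; lia.
by rewrite -(ler_nat R) natrM natrX.
Qed.

End Monomials.

Section MultiIndexSums.
Variables (R : realType) (I : finType).
Implicit Types (G : (I -> nat) -> R).

Definition multi_sum N d G : R :=
  \sum_(al : {ffun I -> 'I_N.+1} | (degree (fun i => al i) <= d)%N) G (fun i => al i).

Lemma multi_sum_widen N d G : (d <= N)%N -> multi_sum N d G = multi_sum d d G.
Proof.
move=> dN.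
pose up (b : {ffun I -> 'I_d.+1}) : {ffun I -> 'I_N.+1} := [ffun i => inord (b i)].
pose dn (b : {ffun I -> 'I_N.+1}) : {ffun I -> 'I_d.+1} := [ffun i => inord (b i)].
have upE b : (fun i => up b i : nat) = (fun i => b i : nat).
  by apply/funext => i; rewrite ffunE inordK // (leq_trans (ltn_ord _)).
have dnE (b : {ffun I -> 'I_N.+1}) :
    (degree (fun i => b i) <= d)%N -> (fun i => dn b i : nat) = (fun i => b i : nat).
  move=> bd; apply/funext => i; rewrite ffunE inordK // ltnS; apply: leq_trans bd.
  by rewrite /degree (bigD1 i) //= leq_addr.
have ffun_eq M (b b' : {ffun I -> 'I_M}) : (fun i => b i : nat) = (fun i => b' i : nat) -> b = b'.
  by move=> e; apply/ffunP => i; apply: val_inj; exact: (congr1 (@^~ i) e).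
rewrite /multi_sum (reindex_onto up dn) /= => [|b bd]; last first.
  by apply: ffun_eq; rewrite upE dnE.
apply: eq_big => [b|b _]; rewrite upE //.
case: leqP => //= bd; apply/eqP; apply: ffun_eq; by rewrite dnE upE.
Qed.

Lemma multi_sum_split N d G : (d <= N)%N -> multi_sum N N G = multi_sum d d G +
  \sum_(al : {ffun I -> 'I_N.+1} | (d < degree (fun i => al i) <= N)%N) G (fun i => al i).
Proof.
move=> dN; rewrite -(multi_sum_widen G dN) /multi_sum.
rewrite (bigID (fun al : {ffun I -> 'I_N.+1} => (degree (fun i => al i) <= d)%N)) /=.
congr (_ + _); apply: eq_bigl => al; last by rewrite andbC -ltnNge.
by case: (leqP (degree _) d) => [h|]; rewrite ?andbF // (leq_trans h dN).
Qed.

Lemma multi_sum_delta N (b : I -> nat) G :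
  multi_sum N N (fun al => `[< al = b >]%:R * G al) = if (degree b <= N)%N then G b else 0.
Proof.
case: leqP => bN; last first.
  rewrite /multi_sum big1 // => al alN; case: asboolP => [alb|_]; last by rewrite mul0r.
  by rewrite alb leqNgt bN in alN.
pose b' : {ffun I -> 'I_N.+1} := [ffun i => inord (b i)].
have b'E : (fun i => b' i : nat) = b.
  apply/funext => i; rewrite ffunE inordK // ltnS; apply: leq_trans bN.
  by rewrite /degree (bigD1 i) //= leq_addr.
rewrite /multi_sum (bigD1 b') /= b'E //; case: asboolP => // _; rewrite mul1r big1 ?addr0 //.
move=> al /andP[_ alb']; case: asboolP => [alb|_]; last by rewrite mul0r.
case/eqP: alb'; apply/ffunP => i; apply: val_inj.
by rewrite -[LHS]/((fun i => al i : nat) i) alb -b'E.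
Qed.

End MultiIndexSums.

Section AnalyticTaylor.
Variables (R : realType) (I : finType).
Implicit Types (x y h l : I -> R) (q : I -> I -> R) (c : (I -> nat) -> R) (f : (I -> R) -> R).

Lemma ps_partialE c y x N :
  ps_partial c y x N = multi_sum N N (fun al => c al * monomial al (x - y)).
Proof. by []. Qed.

Lemma is_quad_ps_partial2 c y : is_quad (fun h => ps_partial c y (y + h) 2).
Proof.
have -> : (fun h => ps_partial c y (y + h) 2) =
    \sum_(al : {ffun I -> 'I_3} | (degree (fun i => al i) <= 2)%N)
      c (fun i => al i) *: (monomial (fun i => al i) : (I -> R) -> R).
  apply/funext => h; rewrite fct_sumE ps_partialE /multi_sum.
  by apply: eq_bigr => al _; rewrite [y + h]addrC addrK.
apply: lin_closed_sum => [|al al2]; first exact: is_quad_lin_closed.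
by apply: lin_closedZ; [exact: is_quad_lin_closed|exact: is_quad_monomial].
Qed.

Lemma ps_tail_lipschitz c y x x' (rho e : R) N : 0 < rho -> e <= rho / 2 ->
  dmax x y <= e -> dmax x' y <= e -> (2 <= N)%N ->
  `|ps_partial c y x N - ps_partial c y x' N - (ps_partial c y x 2 - ps_partial c y x' 2)|
    <= ps_abs_partial c y (y + (fun=> rho)) N * (3 / rho ^+ 3 * e ^+ 2 * dmax x x').
Proof.
move=> r0 er xe x'e N2; rewrite !ps_partialE !(multi_sum_split _ N2).
set D := \sum_(al | _) _; set D' := \sum_(al | _) _.
rewrite [X in `|X|](_ : _ = D - D'); last by ring.
set B := _ * dmax x x'.
have e0 : 0 <= e := le_trans (dmax_ge0 _ _) xe.
have B0 : 0 <= B by rewrite !mulr_ge0 ?invr_ge0 ?exprn_ge0 ?dmax_ge0 ?(ltW r0).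
have absE : ps_abs_partial c y (y + (fun=> rho)) N =
    multi_sum N N (fun al => `|c al| * rho ^+ degree al).
  apply: eq_bigr => al _; congr (_ * _); rewrite -prodrXr; apply: eq_bigr => i _.
  by rewrite [X in `|X - _|]addrC addrK gtr0_norm.
rewrite absE (multi_sum_split _ N2) mulrDl ler_wpDl //.
  by rewrite mulr_ge0 // sumr_ge0 // => al _; rewrite mulr_ge0 ?exprn_ge0 // ltW.
rewrite /D /D' -sumrB mulr_suml; apply: le_trans (ler_norm_sum _ _ _) _.
apply: ler_sum => al /andP[al2 _]; rewrite -mulrBr normrM -mulrA ler_wpM2l // [leRHS]mulrC.
apply: monomial_sub_le_tail => // i.
- exact: le_trans (le_dmax x y i) xe.
- exact: le_trans (le_dmax x' y i) x'e.
- by apply: le_trans (le_dmax x x' i); rewrite !fctE opprB addrA subrK.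
Qed.

Lemma analytic_quad_lipschitz V f y : analytic_at V f y ->
  exists a l q (C rho : R), [/\ symmetric_array q, 0 <= C, 0 < rho &
    forall x x' (e : R), e <= rho -> dmax x y <= e -> dmax x' y <= e ->
      `|(f x - quad a l q (x - y)) - (f x' - quad a l q (x' - y))| <= C * e ^+ 2 * dmax x x'].
Proof.
move=> [r [r0 [c hc]]].
have [a [l [q [qs quadE]]]] := is_quad_ps_partial2 c y.
have r20 : 0 < r / 2 by rewrite divr_gt0.
have y_r : dmax (y + (fun=> r / 2)) y < r.
  apply: le_lt_trans (_ : r / 2 < r); last by lra.
  apply: dmax_le => [|i]; first exact: ltW.
  by rewrite [X in X - _]addrC addrK gtr0_norm.
have [_ [[M hM] _]] := hc _ y_r.
exists a, l, q, (`|M| * (3 / (r / 2) ^+ 3)), (r / 4).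
split=> //; [by rewrite mulr_ge0 // divr_ge0 // exprn_ge0 // ltW|by rewrite divr_gt0|].
move=> x x' e er xe x'e.
have ps_cvg w : dmax w y <= e -> (fun N => ps_partial c y w N) @ \oo --> f w.
  by move=> we; have [|_ [_ ?]] := hc w; first by apply: le_lt_trans we _; lra.
have quad_ps w : quad a l q (w - y) = ps_partial c y w 2 by rewrite -quadE addrC subrK.
pose g N := `|ps_partial c y x N - ps_partial c y x' N -
  (ps_partial c y x 2 - ps_partial c y x' 2)|.
have g_cvg : g @ \oo --> `|f x - f x' - (ps_partial c y x 2 - ps_partial c y x' 2)|.
  by apply: cvg_norm; apply: cvgB; [apply: cvgB; exact: ps_cvg|exact: cvg_cst].
have -> : f x - quad a l q (x - y) - (f x' - quad a l q (x' - y)) =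
    f x - f x' - (ps_partial c y x 2 - ps_partial c y x' 2) by rewrite !quad_ps; ring.
apply: (ler_cvg_to g_cvg (cvg_cst _)); exists 2%N => // N /= N2.
have er2 : e <= r / 2 / 2 by lra.
apply: le_trans (ps_tail_lipschitz c r20 er2 xe x'e N2) _.
rewrite -!mulrA; apply: ler_wpM2r; last by apply: le_trans (hM N) _; exact: ler_norm.
have e0 : 0 <= e := le_trans (dmax_ge0 _ _) xe.
by rewrite !mulr_ge0 ?invr_ge0 ?exprn_ge0 ?dmax_ge0 ?(ltW r20).
Qed.

Definition taylor_rem f y q x : R := f x - quad (f y) (grad f y) q (x - y).

Lemma analytic_taylor_rem V f y : analytic_at V f y -> has_gradient f y (grad f y) /\
  exists q (C rho : R), [/\ symmetric_array q, 0 <= C, 0 < rho &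
    forall x x' (e : R), e <= rho -> dmax x y <= e -> dmax x' y <= e ->
      `|taylor_rem f y q x - taylor_rem f y q x'| <= C * e ^+ 2 * dmax x x'].
Proof.
move=> /analytic_quad_lipschitz [a [l [q [C [rho [qs C0 rho0 lip]]]]]].
have quad_gradient : has_gradient (fun x => quad a l q (x - y)) y l.
  by have := has_gradient_quad a l y y qs; rewrite subrr linear0 addr0.
have rem_gradient : has_gradient (fun x => f x - quad a l q (x - y)) y 0.
  apply: (has_gradient_of_quadratic_error (C := C * rho)).
  apply: filterS (near_dmax_lt y rho0) => x /ltW xr _.
  rewrite dotC linear0 subr0; apply: le_trans (lip x y _ xr (lexx _) _) _.
    by rewrite dmaxxx dmax_ge0.
  by rewrite expr2 !mulrA ler_wpM2r ?dmax_ge0 // ler_wpM2r ?dmax_ge0 // ler_wpM2l.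
have f_gradient : has_gradient f y l.
  have := has_gradientD rem_gradient quad_gradient; rewrite add0r.
  by under [X in has_gradient X]eq_fun do rewrite subrK.
rewrite (has_gradient_grad f_gradient); split=> //; exists q, C, rho; split=> // x x' e er xe x'e.
rewrite /taylor_rem [X in `|X|](_ : _ = (f x - quad a l q (x - y)) - (f x' - quad a l q (x' - y))).
  exact: lip.
by rewrite (has_gradient_grad f_gradient) /quad; ring.
Qed.

End AnalyticTaylor.

Section SecondOrderJets.
Variables (R : realType) (I : finType).
Implicit Types (x y h l : I -> R) (q : I -> I -> R) (f : (I -> R) -> R).

Lemma analytic_has_gradient V f y : analytic_at V f y -> has_gradient f y (grad f y).
Proof. by case/analytic_taylor_rem. Qed.

Lemma real_analytic_near V f y : real_analytic_on V f -> V y -> \forall x \near dmax_nbhs y, V x.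
Proof. by move=> [Vo _] /Vo [r [r0 hr]]; exists r. Qed.

Lemma real_analytic_jet2 V f y : real_analytic_on V f -> V y -> exists q,
  [/\ symmetric_array q,
      exists C, \forall x \near dmax_nbhs y, `|taylor_rem f y q x| <= C * dmax x y ^+ 3 &
      forall i, has_gradient (fun x => pderiv f i x) y (q i)].
Proof.
move=> hf Vy; have [_ [q [C [rho [qs C0 rho0 lip]]]]] := analytic_taylor_rem (proj2 hf y Vy).
exists q; split=> //.
  exists C; apply: filterS (near_dmax_lt y rho0) => x /ltW xr.
  have := lip x y _ xr (lexx _); rewrite dmaxxx dmax_ge0 => /(_ isT).
  by rewrite {2}/taylor_rem subrr quad0 !subrr subr0 -mulrA -exprSr.
move=> i; have rho20 : 0 < rho / 2 by rewrite divr_gt0.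
apply: (has_gradient_of_quadratic_error (C := C * 2 ^+ 2)).
apply: filterS2 (real_analytic_near hf Vy) (near_dmax_lt y rho20) => x Vx xr x0.
have d0 : 0 < dmax x y by rewrite lt_neqAle eq_sym x0 dmax_ge0.
have rem_gradient := has_gradientD (analytic_has_gradient (proj2 hf x Vx))
  (has_gradientN (has_gradient_quad (f y) (grad f y) y x qs)).
have -> : pderiv f i x - pderiv f i y - dot (q i) (x - y) =
    (grad f x - (grad f y + matvec q (x - y))) i by rewrite !fctE /grad /matvec; ring.
apply: has_gradient_le rem_gradient i.
  by rewrite !mulr_ge0 ?exprn_ge0 ?dmax_ge0.
apply: filterS (near_dmax_lt x d0) => x' /ltW x'x; rewrite -mulrA -exprMn.
apply: lip; [lra|have := dmax_triangle x x' y; lra|lra].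
Qed.

Lemma real_analytic_pderiv_bounded V f y : real_analytic_on V f -> V y ->
  exists C, \forall x \near dmax_nbhs y, forall i, `|pderiv f i x| <= C.
Proof.
move=> hf Vy; have [q [_ _ /(_ _)/has_gradient_locally_bounded hq]] := real_analytic_jet2 hf Vy.
have /choice [C hC] := hq; exists (\sum_i `|C i|).
have : \forall x \near dmax_nbhs y, forall i, `|pderiv f i x| <= C i.
  exact: filter_forall.
apply: filterS => x hx i; apply: le_trans (hx i) (le_trans (ler_norm _) _).
by rewrite (bigD1 i) //= ler_wpDr // sumr_ge0.
Qed.

End SecondOrderJets.

Section AnalyticQuadratics.
Variables (R : realType) (I : finType).
Implicit Types (x y h v l : I -> R) (q : I -> I -> R) (f : (I -> R) -> R) (b : I -> nat).

Definition entire_at y f := exists c : (I -> nat) -> R, forall x,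
  (exists M : R, forall N, ps_abs_partial c y x N <= M) /\
  (fun N => ps_partial c y x N) @ \oo --> f x.

Lemma entire_at_analytic y f : entire_at y f -> analytic_at (fun=> True) f y.
Proof. by move=> [c hc]; exists 1; split=> //; exists c => x _; split. Qed.

Lemma entire_at_lin_closed y : lin_closed (entire_at y).
Proof.
split=> [|a f g [c hc] [c' hc']].
  exists (fun=> 0) => x; split.
    by exists 0 => N; rewrite /ps_abs_partial big1 // => al _; rewrite normr0 mul0r.
  have -> : (fun N => ps_partial (fun=> 0) y x N) = (fun=> 0).
    by apply/funext => N; rewrite /ps_partial big1 // => al _; rewrite mul0r.
  exact: cvg_cst.
exists (fun al => a * c al + c' al) => x.
have [[M hM] cv] := hc x; have [[M' hM'] cv'] := hc' x; split.
  exists (`|a| * M + M') => N.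
  apply: le_trans (_ : `|a| * ps_abs_partial c y x N + ps_abs_partial c' y x N <= _); last first.
    by rewrite lerD // ler_wpM2l.
  rewrite /ps_abs_partial mulr_sumr -big_split; apply: ler_sum => al _ /=.
  rewrite mulrA -mulrDl -normrM ler_wpM2r ?ler_normD //.
  by apply: prodr_ge0 => i _; rewrite exprn_ge0.
have -> : (fun N => ps_partial (fun al => a * c al + c' al) y x N) =
    (fun N => a * ps_partial c y x N + ps_partial c' y x N).
  apply: funext => N; rewrite /ps_partial mulr_sumr -big_split; apply: eq_bigr => al _ /=.
  by rewrite mulrDl mulrA.
by apply: cvgD => //; apply: cvgM => //; exact: cvg_cst.
Qed.

Lemma entire_at_monomial y b : entire_at y (fun x => monomial b (x - y)).
Proof.
exists (fun al => `[< al = b >]%:R) => x; split.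
  exists `|monomial b (fun i => `|x i - y i|)| => N.
  have -> : ps_abs_partial (fun al => `[< al = b >]%:R) y x N =
      multi_sum N N (fun al => `[< al = b >]%:R * monomial al (fun i => `|x i - y i|)).
    by apply: eq_bigr => al _; rewrite normr_nat.
  by rewrite multi_sum_delta; case: ifP => // _; exact: ler_norm.
apply: cvg_near_cst; exists (degree b) => // N /= bN.
by rewrite ps_partialE multi_sum_delta bN.
Qed.

Lemma entire_at_quad a l q y : entire_at y (fun x => quad a l q (x - y)).
Proof.
have lc := entire_at_lin_closed y.
have coord i : entire_at y (fun x => (x - y) i).
  have -> : (fun x => (x - y) i) = (fun x => monomial (fun j => (j == i) : nat) (x - y)).
    by apply/funext => x; rewrite monomial_coord.
  exact: entire_at_monomial.
have coord2 i j : entire_at y (fun x => (x - y) i * (x - y) j).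
  have -> : (fun x => (x - y) i * (x - y) j) =
      (fun x => monomial (fun s => (s == i) + (s == j))%N (x - y)).
    by apply/funext => x; rewrite monomialD !monomial_coord.
  exact: entire_at_monomial.
have cst : entire_at y (fun=> 1).
  have -> : (fun=> 1) = (fun x => monomial (fun=> 0%N) (x - y)).
    by apply/funext => x; rewrite /monomial big1.
  exact: entire_at_monomial.
have -> : (fun x => quad a l q (x - y)) = a *: (fun=> 1) + \sum_i l i *: (fun x => (x - y) i) +
    2^-1 *: \sum_i \sum_j q i j *: (fun x => (x - y) i * (x - y) j).
  apply/funext => x; rewrite !fctE !fct_sumE -[a *: 1]/(a * 1) mulr1 /quad; congr (_ + _ * _).
  apply: eq_bigr => i _; rewrite fct_sumE /matvec /dot mulr_sumr; apply: eq_bigr => j _.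
  by rewrite mulrCA.
apply: lin_closedD => //; last first.
  apply: lin_closedZ => //; apply: lin_closed_sum => // i _; apply: lin_closed_sum => // j _.
  exact: lin_closedZ.
apply: lin_closedD => //; first exact: lin_closedZ.
by apply: lin_closed_sum => // i _; apply: lin_closedZ.
Qed.

Lemma real_analytic_quad a l q y : symmetric_array q ->
  real_analytic_on (fun=> True) (fun x => quad a l q (x - y)).
Proof.
move=> qs; split=> [w _|w _]; first by exists 1.
apply: entire_at_analytic.
have -> : (fun x => quad a l q (x - y)) =
    (fun x => quad (quad a l q (w - y)) (l + matvec q (w - y)) q (x - w)).
  apply/funext => x.
  have -> : x - y = (w - y) + (x - w) by rewrite [RHS]addrC addrA subrK.
  by rewrite quadD.
exact: entire_at_quad.
Qed.

Lemma pderiv_quad a l q y i : symmetric_array q -> pderiv (fun x => quad a l q (x - y)) i y = l i.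
Proof.
move=> qs; have := has_gradient_quad a l y y qs; rewrite subrr linear0 addr0.
by move=> /has_gradient_grad /(congr1 (@^~ i)).
Qed.

End AnalyticQuadratics.

Section Restriction.
Variables (R : realType) (n k : nat).
Implicit Types (x l : 'I_n -> R) (y h : Lidx n k -> R) (q : 'I_n -> 'I_n -> R).

Definition extend x y : 'I_n -> R :=
  fun i => match (insub i : option (Lidx n k)) with Some L => y L | None => x i end.

Definition restrict x : Lidx n k -> R := fun L => x (val L).

Lemma extend_shift x h : extend x (restrict x + h) = x + extend 0 h.
Proof.
apply/funext => i; rewrite !fctE /extend; case: insubP => [L _ <-|_] //.
by rewrite [RHS]addr0.
Qed.

Lemma dmax_extend0 h : dmax (extend 0 h) 0 <= dmax h 0.
Proof.
apply: dmax_le => [|i]; first exact: dmax_ge0.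
by rewrite subr0 /extend; case: insub => [L|]; rewrite ?le_dmax0 // normr0 dmax_ge0.
Qed.

Lemma dot_extend0 l h : dot l (extend 0 h) = dot (restrict l) h.
Proof.
rewrite /dot (bigID (fun i : 'I_n => (i < k)%N)) /= [X in _ + X]big1 ?addr0 => [|i ik]; last first.
  by rewrite /extend insubN // mulr0.
rewrite (reindex_omap (val : Lidx n k -> 'I_n) insub) => [|i ik]; last by rewrite insubT.
apply: eq_big => [L|L _]; first by rewrite (valP L) valK eqxx.
by rewrite /extend valK.
Qed.

Lemma quad_extend0 (a : R) l q h :
  quad a l q (extend 0 h) = quad a (restrict l) (fun L => restrict (q (val L))) h.
Proof.
rewrite /quad dot_extend0; congr (_ + _ * _); rewrite dotC dot_extend0 dotC.
by apply: eq_bigr => L _; rewrite /restrict /matvec dot_extend0.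
Qed.

Lemma taylor2_restrict (u : ('I_n -> R) -> R) x q (a C C' : R) (p : Lidx n k -> R) s :
  symmetric_array q -> symmetric_array s ->
  (\forall x' \near dmax_nbhs x, `|taylor_rem u x q x'| <= C * dmax x' x ^+ 3) ->
  (\forall y \near dmax_nbhs (restrict x),
    `|u (extend x y) - quad a p s (y - restrict x)| <= C' * dmax y (restrict x) ^+ 3) ->
  [/\ u x = a, restrict (grad u x) = p & forall L G, q (val L) (val G) = s L G].
Proof.
move=> qs ss [r r0 rem_u] [r' r'0 data_u].
have [L G||-> -> sE] := @quad_inj_cubic_error R _ (u x) a (restrict (grad u x)) p
    (fun L => restrict (q (val L))) s (`|C| + C') _ ss.
- by rewrite /restrict qs.
- exists (Num.min r r') => [|h]; first by rewrite lt_min r0.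
  rewrite lt_min => /andP[hr hr'].
  have shift_dmax (J : finType) (w v : J -> R) : dmax (w + v) w = dmax v 0.
    by rewrite -dmax_sub [w + v]addrC addrK.
  have := data_u (restrict x + h); have := rem_u (x + extend 0 h).
  rewrite !shift_dmax extend_shift /taylor_rem [x + _]addrC addrK [_ + h]addrC addrK.
  rewrite quad_extend0 => /(_ (le_lt_trans (dmax_extend0 h) hr)) hu /(_ hr') hd.
  set X := u _ in hu hd; set Qu := quad (u x) _ _ _ in hu *; set Qa := quad a _ _ _ in hd *.
  have -> : Qu - Qa = (X - Qa) - (X - Qu) by ring.
  rewrite mulrDl [leRHS]addrC; apply: le_trans (ler_normB _ _) (lerD hd _).
  apply: le_trans hu (le_trans (ler_wpM2r _ (ler_norm C)) _); first by rewrite exprn_ge0 ?dmax_ge0.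
  by rewrite ler_wpM2l // lerXn2r ?nnegrE ?dmax_ge0 // dmax_extend0.
by split=> // L G; rewrite -sE.
Qed.

End Restriction.

Section TangentVectors.
Variables (R : realType) (n m k : nat).
Notation V := (Coord n m -> R).
Implicit Types (z u v w : V) (A B : 'I_m) (x y c : 'I_n -> R).

Definition xpart v : 'I_n -> R := fun i => v (inl (inl i)).

Definition jpart v A : 'I_n -> R := fun i => v (inr (A, i)).

(* The lift of the direction [c] to the tangent space of a 2-jet over [z] with
   Hessians [q A]. *)
Definition jet_lift z (q : 'I_m -> 'I_n -> 'I_n -> R) c : V := fun s => match s with
  | inl (inl i) => c i
  | inl (inr A) => dot (zpp z A) c
  | inr (A, i) => matvec (q A) c i
  end.

Fact xpart_is_linear : linear xpart. Proof. by []. Qed.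
HB.instance Definition _ :=
  GRing.isLinear.Build R V ('I_n -> R) *:%R xpart xpart_is_linear.

Fact jet_lift_is_linear z q : linear (jet_lift z q).
Proof.
move=> a c c'; apply/funext => -[[i|A]|[A i]] //=.
  by rewrite linearP.
by rewrite /= (linearP (matvec _)).
Qed.
HB.instance Definition _ z q :=
  GRing.isLinear.Build R ('I_n -> R) V *:%R (jet_lift z q) (jet_lift_is_linear z q).

Fact Fproj_is_linear : linear (@Fproj R n m k).
Proof. by move=> a u v; apply/funext => -[[i|B]|[B L]]. Qed.
HB.instance Definition _ :=
  GRing.isLinear.Build R V (FCoord n m k -> R) *:%R (@Fproj R n m k) Fproj_is_linear.

End TangentVectors.

Section Prolongation.
Variables (R : realType) (n m k : nat).
Variable F : 'I_m -> Gidx n k -> (FCoord n m k -> R) -> R.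
Notation V := (Coord n m -> R).
Implicit Types (z v : V) (A B : 'I_m) (al : Gidx n k) (q : 'I_m -> 'I_n -> 'I_n -> R).

Lemma df_gradient z A al l v : has_gradient (F A al) (Fproj z) l ->
  df F z A al v = jpart v A (val al) - dot l (Fproj v).
Proof.
move=> /(has_gradient_line (Fproj v)) F_line; rewrite /df /dirderiv derive1E.
have -> : (fun t : R => fz F A al (fun i => z i + t * v i)) =
    (fun t => (z + t *: v) (inr (A, val al)) - F A al (Fproj z + t *: Fproj v)).
  by apply/funext => t; rewrite -linearZ -linearD.
have line := is_derive_line z v (inr (A, val al)).
exact: derive_val.
Qed.

Definition rhs_differentiable z :=
  forall A al, has_gradient (F A al) (Fproj z) (grad (F A al) (Fproj z)).

Definition prolongs z q := (forall A, symmetric_array (q A)) /\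
  forall c A al, df F z A al (jet_lift z q c) = 0.

Definition has_prolongations z := forall s : 'I_m -> Lidx n k -> Lidx n k -> R,
  (forall A, symmetric_array (s A)) ->
  exists q, prolongs z q /\ forall A L G, q A (val L) (val G) = s A L G.

Lemma prolongs_of_solution z q (u : 'I_m -> ('I_n -> R) -> R) C :
  rhs_differentiable z -> (forall A, symmetric_array (q A)) ->
  (forall B, u B (zx z) = zp z B) -> (forall B, has_gradient (u B) (zx z) (zpp z B)) ->
  (forall B i, has_gradient (fun x => pderiv (u B) i x) (zx z) (q B i)) ->
  (forall A al, \forall x \near dmax_nbhs (zx z), `|pderiv (u A) (val al) x -
    F A al (Fpt x (fun B => u B x) (fun B G => pderiv (u B) (val G) x))|
      <= C * dmax x (zx z) ^+ 2) ->
  prolongs z q.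
Proof.
move=> hF qs u0 u1 u2 pde; split=> // c A al; rewrite (df_gradient _ (hF A al)).
pose x (t : R) := zx z + t *: c.
pose w (t : R) : FCoord n m k -> R :=
  Fpt (x t) (fun B => u B (x t)) (fun B G => pderiv (u B) (val G) (x t)).
have x0 : x 0 = zx z by rewrite /x scale0r addr0.
have zpp_pderiv B i : pderiv (u B) i (zx z) = zpp z B i.
  by rewrite -(has_gradient_grad (u1 B)).
have w0 : w 0 = Fproj z.
  by apply/funext => -[[i|B]|[B G]]; rewrite /w /= x0 ?u0 ?zpp_pderiv.
have w_derive s : is_derive (0 : R) (1 : R) (w^~ s) (Fproj (jet_lift z q c) s).
  case: s => [[i|B]|[B G]]; first exact: is_derive_line.
    exact: has_gradient_line.
  exact: (has_gradient_line c (u2 B (val G))).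
have F_derive : is_derive (0 : R) (1 : R) (fun t => F A al (w t))
    (dot (grad (F A al) (Fproj z)) (Fproj (jet_lift z q c))).
  by apply: has_gradient_curve w_derive; rewrite w0.
have [_ pde_derive] := is_deriveB (has_gradient_line c (u2 A (val al))) F_derive.
rewrite -[LHS]pde_derive.
suff [_ ->] : is_derive (0 : R) (1 : R)
  (fun t => pderiv (u A) (val al) (x t) - F A al (w t)) 0 by [].
apply: (is_derive0_of_quadratic_error (C := `|C| * dmax c 0 ^+ 2)).
have x_cvg : x @ (0 : R) --> dmax_nbhs (zx z) by exact: cvg_dmax_line.
near=> t.
apply: le_trans (_ : C * dmax (x t) (zx z) ^+ 2 <= _).
  by near: t; exact: x_cvg _ (pde A al).
rewrite -mulrA; apply: le_trans (ler_wpM2r _ (ler_norm C)) _; first by rewrite exprn_ge0 ?dmax_ge0.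
rewrite ler_wpM2l // -[t ^+ 2]real_normK ?num_real // -exprMn.
by rewrite lerXn2r // ?nnegrE ?dmax_ge0 ?mulr_ge0 ?dmax_ge0 // mulrC; exact: dmax_line.
Unshelve. all: by end_near. Qed.

Lemma approx_solvable_prolongations z U :
  (forall A al, analytic_at U (F A al) (Fproj z)) ->
  approx_solvable F (zx z) (zp z) (fun B (L : Lidx n k) => zpp z B (val L)) ->
  (forall A al, fz F A al z = 0) -> has_prolongations z.
Proof.
move=> hF solvable fz0 s ss; set x0 := zx z in solvable *.
pose a A (y : Lidx n k -> R) := quad (zp z A) (restrict (zpp z A)) (s A) (y - restrict x0).
have [||A L|u [[W [Wx hu]] [[C [r [r0 pde]]] [C' [r' [r'0 data]]]]]] := solvable a.
- by exists (fun=> True); split=> // A; exact: real_analytic_quad.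
- by move=> A; rewrite /a subrr quad0.
- by rewrite /a pderiv_quad.
have /choice [q hq] := fun A => real_analytic_jet2 (hu A) Wx.
have matches A : [/\ u A x0 = zp z A, restrict (grad (u A) x0) = restrict (k := k) (zpp z A) &
    forall L G : Lidx n k, q A (val L) (val G) = s A L G].
  have [qs [C1 rem] _] := hq A.
  by apply: (taylor2_restrict qs (ss A) rem (C' := C')); exists r' => // y /data.
have u0 A : u A x0 = zp z A by case: (matches A).
have uL A (L : Lidx n k) : pderiv (u A) (val L) x0 = zpp z A (val L).
  by have [_ /(congr1 (@^~ L)) + _] := matches A.
have w0 : Fpt x0 (fun B => u B x0) (fun B (G : Lidx n k) => pderiv (u B) (val G) x0) = Fproj z.
  by apply/funext => -[[i|B]|[B G]] /=; rewrite ?u0 ?uL.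
have u_gradient A : has_gradient (u A) x0 (zpp z A).
  rewrite (_ : zpp z A = grad (u A) x0); first exact: analytic_has_gradient (proj2 (hu A) _ Wx).
  apply/funext => i; have [ik|ki] := ltnP i k; first exact: esym (uL A (exist _ i ik)).
  have := pde x0; rewrite dmaxxx expr0n mulr0 => /(_ r0 A (exist _ i ki)).
  rewrite w0 normr_le0 subr_eq0 /grad => /eqP /= ->.
  by have /eqP := fz0 A (exist _ i ki); rewrite subr_eq0 => /eqP.
exists q; split; last by move=> A; case: (matches A).
apply: (@prolongs_of_solution _ _ u C) => //.
- by move=> A al; exact: analytic_has_gradient.
- by move=> A; case: (hq A).
- by move=> B; have [_ _] := hq B.
by move=> A al; exists r => // x /pde.
Qed.

End Prolongation.

Section LinearSystems.
Variable K : fieldType.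

Lemma scalar_sum (V : lmodType K) (f : V -> K) (I : finType) (c : I -> K) (u : I -> V) :
  scalar f -> f (\sum_i c i *: u i) = \sum_i c i * f (u i).
Proof.
move=> f_scalar.
pose g : {scalar V} := HB.pack f (GRing.isLinear.Build K V K *%R f f_scalar).
by rewrite -[f]/(g : V -> K) linear_sum; apply: eq_bigr => i _; rewrite scalarZ.
Qed.

Lemma square_system_solvable (I : finType) (M : I -> I -> K) :
  (forall x : I -> K, (forall i, \sum_j M i j * x j = 0) -> forall j, x j = 0) ->
  forall c : I -> K, exists x : I -> K, forall i, \sum_j M i j * x j = c i.
Proof.
move=> inj c.
pose A : 'M[K]_#|I| := \matrix_(a, b) M (enum_val a) (enum_val b).
have sumE (x : 'cV[K]_#|I|) i :
    \sum_j M i j * x (enum_rank j) 0 = (A *m x) (enum_rank i) 0.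
  rewrite mxE (reindex (@enum_rank I)) /=; last first.
    by exists enum_val => ? _; rewrite ?enum_rankK ?enum_valK.
  by apply: eq_bigr => j _; rewrite mxE !enum_rankK.
have A_unit : A \in unitmx.
  rewrite -unitmx_tr -row_free_unit; apply: inj_row_free => v hv.
  apply/rowP => b; rewrite mxE -(enum_valK b).
  have /= := inj (fun j => v^T (enum_rank j) 0) _ (enum_val b).
  rewrite mxE; apply => i; rewrite sumE.
  by rewrite -[A]trmxK -trmx_mul hv trmx0 mxE.
exists (fun j => (invmx A *m \col_a c (enum_val a)) (enum_rank j) 0) => i.
by rewrite sumE mulKVmx // mxE enum_rankK.
Qed.

Lemma injective_system_solvable (V : lmodType K) (I : finType) (Z : V -> Prop)
    (p mu : I -> V -> K) : lin_closed Z ->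
  (forall i, scalar (p i)) -> (forall i, scalar (mu i)) ->
  (forall x : I -> K, exists2 u, Z u & forall i, p i u = x i) ->
  (forall u, Z u -> (forall i, mu i u = 0) -> forall i, p i u = 0) ->
  forall c : I -> K, exists2 u, Z u & forall i, mu i u = c i.
Proof.
move=> Z_lin p_lin mu_lin surj inj c.
have /choice [u hu] : forall j, exists u, Z u /\ forall i, p i u = (i == j)%:R.
  by move=> j; have [u Zu pu] := surj (fun i => (i == j)%:R); exists u.
have Zsum (x : I -> K) : Z (\sum_j x j *: u j).
  by apply: lin_closed_sum => // j _; apply: lin_closedZ => //; case: (hu j).
have muE x i : mu i (\sum_j x j *: u j) = \sum_j mu i (u j) * x j.
  by rewrite scalar_sum //; apply: eq_bigr => j _; rewrite mulrC.
have [x x0 j|x hx] := @square_system_solvable I (fun i j => mu i (u j)) _ c; last first.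
  by exists (\sum_j x j *: u j) => // i; rewrite muE.
have mu0 i : mu i (\sum_j x j *: u j) = 0 by rewrite muE.
rewrite -[RHS](inj _ (Zsum x) mu0 j) scalar_sum // (bigD1 j) //= big1 => [|i ij].
  by have [_ ->] := hu j; rewrite eqxx mulr1 addr0.
by have [_ ->] := hu i; rewrite eq_sym (negbTE ij) mulr0.
Qed.

End LinearSystems.

Section SymmetricArrays.
Variables (R : realType) (J : finType).
Implicit Types (s : J -> J -> R).

Definition upper_pair := {p : J * J | (enum_rank p.1 <= enum_rank p.2)%N}.

Lemma symmetric_array_of_upper (x : upper_pair -> R) :
  exists s, symmetric_array s /\ forall p : upper_pair, s (val p).1 (val p).2 = x p.
Proof.
pose x' p := oapp x 0 (insub p : option upper_pair).
exists (fun i j => if (enum_rank i <= enum_rank j)%N then x' (i, j) else x' (j, i)).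
split=> [i j|p]; last by rewrite (valP p) /x' -surjective_pairing valK.
case: ltngtP => // ij; suff -> : i = j by [].
by apply: enum_rank_inj; apply: val_inj.
Qed.

Lemma symmetric_array_eq s s' : symmetric_array s -> symmetric_array s' ->
  (forall p : upper_pair, s (val p).1 (val p).2 = s' (val p).1 (val p).2) ->
  forall i j, s i j = s' i j.
Proof.
move=> ss ss' eq_upper i j; have [ij|/ltnW ji] := leqP (enum_rank i) (enum_rank j).
  exact: (eq_upper (exist _ (i, j) ij)).
by rewrite ss ss'; exact: (eq_upper (exist _ (j, i) ji)).
Qed.

End SymmetricArrays.

Section Symbol.
Variables (R : realType) (n m k : nat).
Variable F : 'I_m -> Gidx n k -> (FCoord n m k -> R) -> R.
Variable z : Coord n m -> R.
Hypothesis F_diff : rhs_differentiable F z.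
Implicit Types (A B : 'I_m) (al : Gidx n k) (L G : Lidx n k) (W : 'I_m -> 'I_n -> R).

Definition vert W : Coord n m -> R :=
  fun s => match s with inl _ => 0 | inr p => W p.1 p.2 end.

Lemma vert_lin a W W' : vert (a *: W + W') = a *: vert W + vert W'.
Proof. by apply: funext => -[s|s] //; rewrite !fctE scaler0 addr0. Qed.

Lemma df_is_scalar A al : scalar (df F z A al).
Proof.
move=> a u v; rewrite !(df_gradient _ (F_diff A al)) linearD linearZ (linearD (dot _)) /=.
by rewrite (scalarZ (dot _)) /= /jpart !fctE -[_ *: u _]/(_ * _); ring.
Qed.

Lemma df_vert A al W : df F z A al (vert W) = W A (val al) -
  \sum_(s : 'I_m * Lidx n k) pderiv (F A al) (inr s) (Fproj z) * W s.1 (val s.2).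
Proof.
rewrite (df_gradient _ (F_diff A al)) /dot big_sumType /=; congr (_ - _).
rewrite big1 ?add0r => [|[i|B] _]; rewrite /= ?mulr0 //.
by apply: eq_bigr => -[B L].
Qed.

Definition in_symbol W := forall A al, df F z A al (vert W) = 0.

Lemma in_symbol_lin_closed : lin_closed in_symbol.
Proof.
split=> [A al|a W W' hW hW' A al].
  by rewrite df_vert big1 ?subr0 // => s _; rewrite mulr0.
by rewrite vert_lin df_is_scalar hW hW' mulr0 addr0.
Qed.

Lemma in_symbol_of_tangential (x : 'I_m -> Lidx n k -> R) :
  exists2 W, in_symbol W & forall A L, W A (val L) = x A L.
Proof.
pose normal A al := \sum_s pderiv (F A al) (inr s) (Fproj z) * x s.1 s.2.
pose W A := extend (fun i => oapp (normal A) 0 (insub i)) (x A).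
have WL A L : W A (val L) = x A L by rewrite /W /extend valK.
exists W => // A al; rewrite df_vert.
have -> : W A (val al) = normal A al by rewrite /W /extend insubN ?valK // -leqNgt (valP al).
by apply/eqP; rewrite subr_eq0; apply/eqP; apply: eq_bigr => s _; rewrite WL.
Qed.

Definition noncharacteristic (Y : Lidx n k -> 'I_n -> R) := forall W, in_symbol W ->
  (forall A L, dot (W A) (Y L) = 0) -> forall A i, W A i = 0.

(* A symbol tensor is controlled by its components along [x^1, ..., x^k], which
   differ little from its contractions with [Y]. *)
Lemma noncharacteristic_near_basis Y (C e : R) : 0 <= C -> 0 <= e ->
  (forall A al s, `|pderiv (F A al) (inr s) (Fproj z)| <= C) ->
  (forall L, dmax (Y L) (basis_vec (val L)) <= e) ->
  (#|{: 'I_m * Lidx n k}|)%:R * (n%:R * (1 + C)) * e < 1 -> noncharacteristic Y.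
Proof.
move=> C0 e0 F_le Y_near small W hW WY.
set S := \sum_(s : 'I_m * Lidx n k) `|W s.1 (val s.2)|.
have S0 : 0 <= S by exact: sumr_ge0.
have W_le A i : `|W A i| <= (1 + C) * S.
  rewrite mulrDl mul1r; have [ik|ki] := ltnP i k.
    apply: le_trans (_ : S <= _); last by rewrite lerDl mulr_ge0.
    by rewrite /S (bigD1 (A, exist _ i ik)) //= lerDl sumr_ge0.
  have /eqP := hW A (exist _ i ki); rewrite df_vert subr_eq0 => /eqP /= ->.
  apply: le_trans (ler_norm_sum _ _ _) (le_trans (_ : _ <= C * S) _); last by rewrite lerDr.
  by rewrite mulr_sumr; apply: ler_sum => s _; rewrite normrM ler_wpM2r.
have WL_le A L : `|W A (val L)| <= n%:R * (1 + C) * e * S.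
  have -> : W A (val L) = dot (W A) (basis_vec (val L) - Y L).
    by rewrite (linearB (dot _)) /= dot_basis WY subr0.
  apply: le_trans (dot_le _ _) _; rewrite dmax_sub mulrAC.
  apply: ler_pM; rewrite ?sumr_ge0 ?dmax_ge0 //; last by rewrite dmaxC.
  rewrite -mulrA mulr_natl -[X in _ *+ X]card_ord -sumr_const.
  by apply: ler_sum => i _; exact: W_le.
have S_le : S <= (#|{: 'I_m * Lidx n k}|)%:R * (n%:R * (1 + C)) * e * S.
  rewrite -!mulrA mulr_natl -sumr_const; apply: ler_sum => -[A L] _.
  by rewrite !mulrA; exact: WL_le.
have S_eq0 : S = 0.
  apply/eqP; rewrite eq_le S0 andbT leNgt; apply/negP => S_gt0.
  by move: S_le; rewrite leNgt => /negP; apply; rewrite gtr_pMl.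
by move=> A i; apply/eqP; rewrite -normr_le0 (le_trans (W_le A i)) // S_eq0 mulr0.
Qed.

Lemma in_symbol_prescribed Y (N : 'I_m -> Lidx n k -> R) : noncharacteristic Y ->
  exists2 W, in_symbol W & forall A L, dot (W A) (Y L) = N A L.
Proof.
move=> nonchar.
have [|||x|W hW WY|W hW WN] := @injective_system_solvable R _ ('I_m * Lidx n k)%type in_symbol
  (fun s W => W s.1 (val s.2)) (fun s W => dot (W s.1) (Y s.2)) _ _ _ _ _ (fun s => N s.1 s.2).
- exact: in_symbol_lin_closed.
- by move=> s a W W'.
- by move=> s a W W'; rewrite -dotZDl.
- have [W hW Wx] := in_symbol_of_tangential (fun A L => x (A, L)).
  by exists W => // -[A L]; exact: Wx.
- by move=> s; apply: nonchar => // A L; exact: (WY (A, L)).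
by exists W => // A L; exact: (WN (A, L)).
Qed.

Definition in_symbol2 (d : 'I_m -> 'I_n -> 'I_n -> R) :=
  (forall A, symmetric_array (d A)) /\ forall c, in_symbol (fun A => matvec (d A) c).

Lemma in_symbol2_lin_closed : lin_closed in_symbol2.
Proof.
split=> [|a d d' [ds dW] [d's d'W]].
  split=> // c; rewrite (_ : (fun A => _) = 0); first by case: in_symbol_lin_closed.
  by apply/funext => A; apply/funext => i; rewrite /matvec dotC linear0.
split=> [A i j|c]; first by rewrite !fctE ds d's.
rewrite (_ : (fun A => _) = a *: (fun A => matvec (d A) c) + (fun A => matvec (d' A) c)).
  by case: in_symbol_lin_closed => _; apply.
by apply/funext => A; rewrite matvecZDl.
Qed.

Lemma prolongsD q d : prolongs F z q -> prolongs F z (d + q) <-> in_symbol2 d.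
Proof.
move=> [qs qD].
have df_lift c A al :
    df F z A al (jet_lift z (d + q) c) = df F z A al (vert (fun B => matvec (d B) c)).
  have -> : jet_lift z (d + q) c = 1 *: vert (fun B => matvec (d B) c) + jet_lift z q c.
    rewrite scale1r; apply/funext => -[[i|B]|[B i]]; rewrite [in RHS]addrfctE /= ?add0r //.
    by rewrite matvecDl.
  by rewrite df_is_scalar qD mul1r addr0.
split=> [[dqs dqD]|[ds dD]]; split=> [A i j|c A al].
- by apply: (addIr (q A i j)); rewrite {2}qs; exact: dqs.
- by rewrite -df_lift.
- by rewrite !fctE ds qs.
- by rewrite df_lift; exact: dD.
Qed.

Lemma in_symbol2_eq0 Y d : noncharacteristic Y -> in_symbol2 d ->
  (forall A L G, dot (Y L) (matvec (d A) (Y G)) = 0) -> forall A i j, d A i j = 0.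
Proof.
move=> nonchar [ds dW] dY A i j.
have dYG G B : matvec (d B) (Y G) = 0.
  by apply/funext => s; apply: (nonchar _ (dW (Y G))) => C L; rewrite dotC.
rewrite -[d A i j](dot_basis (d A i)).
apply: (nonchar _ (dW (basis_vec j)) _ A i) => B L.
by rewrite dotC dot_matvecC // dYG linear0.
Qed.

(* The 2-jets given by solvability are prescribed on [d/dx^L], [L < k]; being
   noncharacteristic lets us prescribe them on the nearby frame [Y] instead. *)
Lemma prolongs_prescribed Y (N : 'I_m -> Lidx n k -> Lidx n k -> R) :
  has_prolongations F z -> noncharacteristic Y -> (forall A, symmetric_array (N A)) ->
  exists2 q, prolongs F z q & forall A L G, dot (Y L) (matvec (q A) (Y G)) = N A L G.
Proof.
move=> jets nonchar Ns.
have [q0 [q0_prol q0L]] := jets (fun _ _ _ => 0) (fun A L G => erefl).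
pose I := ('I_m * upper_pair (Lidx n k))%type.
pose L1 (s : I) := (val s.2).1; pose L2 (s : I) := (val s.2).2.
have form_lin a d d' A L G : dot (Y L) (matvec ((a *: d + d') A) (Y G)) =
    a * dot (Y L) (matvec (d A) (Y G)) + dot (Y L) (matvec (d' A) (Y G)).
  by rewrite matvecZDl (linearD (dot _)) (scalarZ (dot _)).
have form_sym q A : symmetric_array (q A) ->
    symmetric_array (fun L G => dot (Y L) (matvec (q A) (Y G))).
  by move=> qs L G; rewrite dot_matvecC.
have [|||x|d d_sym dY|d d_sym dN] := @injective_system_solvable R _ I in_symbol2
  (fun s d => d s.1 (val (L1 s)) (val (L2 s)))
  (fun s d => dot (Y (L1 s)) (matvec (d s.1) (Y (L2 s)))) _ _ _ _ _
  (fun s => N s.1 (L1 s) (L2 s) - dot (Y (L1 s)) (matvec (q0 s.1) (Y (L2 s)))).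
- exact: in_symbol2_lin_closed.
- by move=> s a d d'.
- by move=> s a d d'; exact: form_lin.
- have /choice [s hs] := fun A => symmetric_array_of_upper (fun p => x (A, p)).
  have [q1 [q1_prol q1L]] := jets s (fun A => proj1 (hs A)).
  exists (q1 - q0) => [|[A p]]; first by apply/(prolongsD _ q0_prol); rewrite subrK.
  by rewrite !fctE q1L q0L subr0; exact: (proj2 (hs A)).
- move=> s; apply: (in_symbol2_eq0 nonchar d_sym) => A.
  apply: symmetric_array_eq => // [|p]; first exact: form_sym (proj1 d_sym A).
  exact: (dY (A, p)).
exists (d + q0) => [|A]; first exact/prolongsD.
apply: symmetric_array_eq => // [|p].
  by apply: form_sym; case: (proj2 (prolongsD _ q0_prol) d_sym).
by rewrite addrfctE matvecDl (linearD (dot _)) /= (dN (A, p)) subrK.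
Qed.

End Symbol.

Section DualFamilies.
Variables (R : realType) (I : finType) (d : nat).
Implicit Types (w th : 'I_d -> I -> R).

Definition dual_to w th := forall i j, dot (th i) (w j) = (i == j)%:R.

Lemma lin_indep_dual w : lin_indep w -> exists th, dual_to w th.
Proof.
move=> w_free; pose M : 'M[R]_(d, #|I|) := \matrix_(j, s) w j (enum_val s).
have M_free : row_free M.
  apply: inj_row_free => v vM; apply/rowP => j; rewrite mxE.
  apply: (w_free (fun j => v 0 j)) => s; have /rowP/(_ (enum_rank s)) := vM.
  rewrite !mxE => vMs; rewrite -[RHS]vMs; apply: eq_bigr => i _.
  by rewrite [M _ _]mxE enum_rankK.
exists (fun i s => pinvmx M (enum_rank s) i) => i j.
have /matrixP/(_ j i) := mulmxVp M_free; rewrite !mxE eq_sym => <-.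
rewrite (reindex (@enum_rank I)) /=; last by exists enum_val => ? _; rewrite ?enum_rankK ?enum_valK.
by apply: eq_bigr => s _; rewrite [M _ _]mxE enum_rankK mulrC.
Qed.

End DualFamilies.

Section ExteriorForms.
Variables (R : realType) (n m : nat).
Notation V := (Coord n m -> R).
Notation form d := (form R n m d).
Implicit Types (u v : V) (A : 'I_m) (th : V -> R).

Lemma OmegaC A u v : Omega A u v = - Omega A v u.
Proof. by rewrite /Omega -sumrN; apply: eq_bigr => i _; ring. Qed.

Lemma Omegaxx A v : Omega A v v = 0.
Proof. by rewrite /Omega big1 // => i _; rewrite subrr. Qed.

Lemma altform0 d : altform ((fun=> 0) : form d).
Proof. by split=> // *; rewrite mulr0 addr0. Qed.

Lemma altform_deg0 (phi : form 0) : altform phi.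
Proof. by split=> [vs []|vs []]. Qed.

Definition det_form d (w : 'I_d -> V) : form d := fun vs => \det (\matrix_(i, j) dot (w j) (vs i)).

Lemma altform_det_form d (w : 'I_d -> V) : altform (det_form w).
Proof.
split=> [vs j a u v|vs i j ij vs_eq]; last first.
  by apply: (determinant_alternate ij) => c; rewrite !mxE vs_eq.
rewrite /det_form -[X in _ + X]mul1r; apply: (@determinant_multilinear _ _ _ _ _ j).
- by apply/rowP => c; rewrite !mxE /upd eqxx mul1r -(scalarZ (dot _)) -(linearD (dot _)).
- by apply/matrixP => r c; rewrite !mxE /upd eq_sym (negbTE (neq_lift _ _)).
- by apply/matrixP => r c; rewrite !mxE /upd eq_sym (negbTE (neq_lift _ _)).
Qed.

Lemma det_form_dual d (e w : 'I_d -> V) : dual_to e w -> det_form w e = 1.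
Proof.
move=> ew; rewrite /det_form (_ : \matrix_(i, j) _ = 1%:M) ?det1 //.
by apply/matrixP => i j; rewrite !mxE ew eq_sym.
Qed.

Definition vcons d v (e : 'I_d -> V) : 'I_d.+1 -> V :=
  fun j => match unlift ord0 j with Some i => e i | None => v end.

Lemma vcons0 d v (e : 'I_d -> V) : vcons v e ord0 = v.
Proof. by rewrite /vcons unlift_none. Qed.

Lemma vcons_lift d v (e : 'I_d -> V) i : vcons v e (lift ord0 i) = e i.
Proof. by rewrite /vcons liftK. Qed.

Lemma vcons_eta d (e : 'I_d.+1 -> V) : e = vcons (e ord0) (fun i => e (lift ord0 i)).
Proof. by apply/funext => j; rewrite /vcons; case: unliftP => [i ->|->]. Qed.

Lemma vconsP d v (e : 'I_d -> V) (P : V -> Prop) :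
  (forall j, P (vcons v e j)) <-> P v /\ forall i, P (e i).
Proof.
split=> [Pve|[Pv Pe] j]; last by rewrite /vcons; case: unliftP.
by split=> [|i]; [rewrite -(vcons0 v e)|rewrite -(vcons_lift v e)].
Qed.

Definition interior d v (phi : form d.+1) : form d := fun e => phi (vcons v e).

Lemma wedge1ZBr d th a (be be' : form d) vs :
  wedge1 th (fun e => a * be e - be' e) vs = a * wedge1 th be vs - wedge1 th be' vs.
Proof.
by rewrite /wedge1 mulr_sumr -sumrB; apply: eq_bigr => j _ /=; ring.
Qed.

Lemma wedge1_right0 d th vs : wedge1 th ((fun=> 0) : form d) vs = 0.
Proof. by rewrite /wedge1 big1 // => j _; rewrite mulr0. Qed.

Lemma wedge1_eq0 d th (be : form d) vs : (forall j, th (vs j) = 0) -> wedge1 th be vs = 0.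
Proof. by move=> h; rewrite /wedge1 big1 // => j _; rewrite h mulr0 mul0r. Qed.

Lemma wedge1_vcons_expand d th (be : form d) v e : wedge1 th be (vcons v e) =
  th v * be e + \sum_(j < d)
    (-1) ^+ j.+1 * th (e j) * be (fun i => vcons v e (lift (lift ord0 j) i)).
Proof.
rewrite /wedge1 big_ord_recl expr0 mul1r vcons0; congr (_ * be _ + _).
  by apply: funext => i; rewrite vcons_lift.
by apply: eq_bigr => j _; rewrite vcons_lift.
Qed.

Lemma wedge1_vcons_vanish d th (be : form d) v e :
  (forall j, th (e j) = 0) -> wedge1 th be (vcons v e) = th v * be e.
Proof.
by move=> h; rewrite wedge1_vcons_expand big1 ?addr0 // => j _; rewrite h mulr0 mul0r.
Qed.

Lemma wedge1_deg0_vcons th (be : form 0) v e : wedge1 th be (vcons v e) = th v * be e.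
Proof. by apply: wedge1_vcons_vanish => -[]. Qed.

Lemma wedge1_vcons d th (be : form d.+1) v e :
  wedge1 th be (vcons v e) = th v * be e - wedge1 th (interior v be) e.
Proof.
rewrite wedge1_vcons_expand /wedge1 -sumrN; congr (_ + _); apply: eq_bigr => j _.
rewrite exprS mulN1r !mulNr; congr (- (_ * be _)); apply/funext => i.
case: (unliftP ord0 i) => [i' ->|->].
  have -> : lift (lift ord0 j) (lift ord0 i') = lift ord0 (lift j i') :> 'I_d.+2.
    by apply: val_inj; rewrite /= /bump !leq0n !add1n ltnS addnS.
  by rewrite !vcons_lift.
have -> : lift (lift ord0 j) ord0 = ord0 :> 'I_d.+2 by apply: val_inj.
by rewrite !vcons0.
Qed.

Lemma wedge1_Omega d A (be : form d) v e : wedge1 (Omega A v) be e =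
  \sum_(i < n) (dpp A i v * wedge1 (dx i) be e - dx i v * wedge1 (dpp A i) be e).
Proof.
rewrite /wedge1; under [RHS]eq_bigr do rewrite !mulr_sumr -sumrB.
rewrite exchange_big; apply: eq_bigr => j _ /=.
by rewrite /Omega mulr_sumr mulr_suml; apply: eq_bigr => i _; ring.
Qed.

Lemma Omega_wedge_deg0_vcons A (de : form 0) v e :
  Omega_wedge A de (vcons v e) = wedge1 (Omega A v) de e.
Proof.
rewrite wedge1_Omega; apply: eq_bigr => i _; rewrite [e]vcons_eta.
rewrite wedge1_vcons !wedge1_deg0_vcons /interior wedge1_deg0_vcons; ring.
Qed.

(* Contraction with [v] is an antiderivation, applied to [dp_i /\ dx^i /\ de]. *)
Lemma Omega_wedge_vcons d A (de : form d.+1) v e :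
  Omega_wedge A de (vcons v e) =
  wedge1 (Omega A v) de e + Omega_wedge A (interior v de) e.
Proof.
rewrite wedge1_Omega /Omega_wedge -big_split; apply: eq_bigr => i _ /=.
have interior_dx : interior v (wedge1 (dx i) de) =
    (fun e' => dx i v * de e' - wedge1 (dx i) (interior v de) e').
  by apply/funext => e'; rewrite /interior wedge1_vcons.
by rewrite wedge1_vcons interior_dx wedge1ZBr; ring.
Qed.

Lemma Omega_wedge_isotropic d A (de : form d) e :
  (forall i j, Omega A (e i) (e j) = 0) -> Omega_wedge A de e = 0.
Proof.
elim: d de e => [|d IH] de e iso; rewrite [e]vcons_eta.
  by rewrite Omega_wedge_deg0_vcons wedge1_eq0.
by rewrite Omega_wedge_vcons IH // addr0 wedge1_eq0.
Qed.

Lemma Omega_wedge_vcons_isotropic d A (de : form d) v e :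
  (forall i j, Omega A (e i) (e j) = 0) ->
  Omega_wedge A de (vcons v e) = wedge1 (Omega A v) de e.
Proof.
case: d de e => [|d] de e iso; first exact: Omega_wedge_deg0_vcons.
by rewrite Omega_wedge_vcons Omega_wedge_isotropic // addr0.
Qed.

End ExteriorForms.

Section Ideal.
Variables (R : realType) (n m k : nat).
Variable F : 'I_m -> Gidx n k -> (FCoord n m k -> R) -> R.
Notation V := (Coord n m -> R).
Notation form d := (form R n m d).
Implicit Types (z v : V) (A B : 'I_m) (al : Gidx n k).

Lemma omega_part0 z d : omega_part z ((fun=> 0) : form d.+1).
Proof.
case: d => [|d] //; exists (fun _ _ => 0); split=> [A|vs]; first exact: altform0.
rewrite big1 // => A _; rewrite /Omega_wedge big1 // => i _.
by rewrite /wedge1 big1 // => j _; rewrite big1 ?mulr0 // => j' _; rewrite mulr0.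
Qed.

Lemma inI_one_part z d (r : form d) : one_part F z r -> inI F z r.
Proof.
move=> hr; exists (fun _ _ _ => 0), r; split=> [A al|]; first exact: altform0.
by split=> // vs; rewrite big1 ?add0r // => A _; rewrite big1 // => al _; rewrite mulr0.
Qed.

Lemma inI_fz z A al : inI F z (fun _ : 'I_0 -> V => fz F A al z).
Proof.
exists (fun B => if B == A then (fun be => if be == al then (fun=> 1) else fun=> 0)
                 else fun _ _ => 0).
exists (fun=> 0).
split=> [B be|]; first exact: altform_deg0.
split=> // vs; rewrite addr0.
rewrite (sum_if_eq (G := fun B G => \sum_be fz F B be z * G be vs)) => [|B]; last first.
  by rewrite big1 // => be _; rewrite mulr0.
rewrite (sum_if_eq (G := fun be G => fz F A be z * G vs)) ?mulr1 // => be.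
by rewrite mulr0.
Qed.

Lemma inI_df z d A al (phi : form d) : altform phi -> inI F z (wedge1 (df F z A al) phi).
Proof.
move=> phi_alt; apply: inI_one_part.
exists (fun B => if B == A then (fun be => if be == al then phi else fun=> 0)
                 else fun _ _ => 0).
exists (fun _ _ => 0), (fun=> 0).
split=> [B be|]; first by case: ifP => // _; [case: ifP => // _|]; exact: altform0.
split=> [B|]; first exact: altform0.
split=> [|vs]; first exact: omega_part0.
rewrite [X in _ + X + _]big1 ?addr0 => [|B _]; last exact: wedge1_right0.
rewrite (sum_if_eq (G := fun B G => \sum_be wedge1 (df F z B be) (G be) vs)) => [|B]; last first.
  by rewrite big1 // => be _; exact: wedge1_right0.
rewrite (sum_if_eq (G := fun be G => wedge1 (df F z A be) G vs)) // => be.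
exact: wedge1_right0.
Qed.

Lemma inI_eta z d A (phi : form d) : altform phi -> inI F z (wedge1 (eta z A) phi).
Proof.
move=> phi_alt; apply: inI_one_part.
exists (fun _ _ _ => 0), (fun B => if B == A then phi else fun=> 0), (fun=> 0).
split=> [B be|]; first exact: altform0.
split=> [B|]; first by case: ifP => // _; exact: altform0.
split=> [|vs]; first exact: omega_part0.
rewrite big1 => [|B _]; last by rewrite big1 // => be _; exact: wedge1_right0.
rewrite add0r addr0 (sum_if_eq (G := fun B G => wedge1 (eta z B) G vs)) // => B.
exact: wedge1_right0.
Qed.

Lemma inI_Omega z d A (phi : form d) : altform phi -> inI F z (Omega_wedge A phi).
Proof.
move=> phi_alt; apply: inI_one_part.
exists (fun _ _ _ => 0), (fun _ _ => 0), (Omega_wedge A phi).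
split=> [B be|]; first exact: altform0.
split=> [B|]; first exact: altform0.
split=> [|vs]; last first.
  rewrite big1 => [|B _]; last by rewrite big1 // => be _; exact: wedge1_right0.
  by rewrite big1 ?add0r // => B _; exact: wedge1_right0.
exists (fun B => if B == A then phi else fun=> 0); split=> [B|vs].
  by case: ifP => // _; exact: altform0.
rewrite (sum_if_eq (G := fun B G => Omega_wedge B G vs)) // => B.
rewrite /Omega_wedge big1 // => i _; rewrite {1}/wedge1 big1 // => j _.
by rewrite wedge1_right0 mulr0.
Qed.

Definition pfaffian_null z v :=
  (forall A, eta z A v = 0) /\ (forall A al, df F z A al v = 0).

Definition integral_vectors z d (e : 'I_d -> V) :=
  [/\ forall A al, fz F A al z = 0, forall a, pfaffian_null z (e a) &
      forall A a b, Omega A (e a) (e b) = 0].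

Lemma inI_integral_vectors z d (phi : form d) (e : 'I_d -> V) :
  integral_vectors z e -> inI F z phi -> phi e = 0.
Proof.
move=> [fz0 null iso] [ga [r [_ [r_one ->]]]].
rewrite big1 ?add0r => [|A _]; last by rewrite big1 // => al _; rewrite fz0 mul0r.
case: d phi e ga r null iso r_one => [|d] phi e ga r null iso; first exact.
move=> [al [be [om [_ [_ [om_omega ->]]]]]].
rewrite big1 => [|A _]; last by rewrite big1 // => a _; rewrite wedge1_eq0 // => j; case: (null j).
rewrite big1 ?addr0 ?add0r => [|A _]; last by rewrite wedge1_eq0 // => j; case: (null j).
case: d om om_omega e {phi ga r al be null} iso => [|d] om om_omega e iso; first exact: om_omega.
have [de [_ ->]] := om_omega.
by rewrite big1 // => A _; exact: Omega_wedge_isotropic.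
Qed.

Lemma in_span_basis d (e : 'I_d -> V) j : in_span e (e j).
Proof.
exists (basis_vec j) => s.
by rewrite -[RHS]/(dot (basis_vec j) (fun i => e i s)) dotC dot_basis.
Qed.

Lemma integral_element_vectors z d (e : 'I_d -> V) :
  integral_element F z e -> integral_vectors z e.
Proof.
move=> [_ vanish].
have one_form th : inI F z (wedge1 th (fun _ : 'I_0 -> V => 1)) -> forall a, th (e a) = 0.
  move=> th_in a; have := vanish _ _ th_in (fun=> e a) (fun=> in_span_basis e a).
  by rewrite /wedge1 big_ord_recl big_ord0 addr0 expr0 mul1r mulr1.
split=> [A al|a|A a b].
- by apply: (vanish _ _ (inI_fz z A al) (fun=> 0)) => -[].
- by split=> [A|A al]; apply: one_form; [apply: inI_eta|apply: inI_df]; exact: altform_deg0.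
have := vanish _ _ (inI_Omega z A (altform_deg0 (fun=> 1))) (vcons (e a) (fun=> e b)).
rewrite Omega_wedge_deg0_vcons /wedge1 big_ord_recl big_ord0 addr0 expr0 mul1r mulr1; apply.
by apply/vconsP; split=> *; exact: in_span_basis.
Qed.

Lemma integral_vectors_vcons z d v (e : 'I_d -> V) : integral_vectors z e ->
  integral_vectors z (vcons v e) <-> pfaffian_null z v /\ forall A a, Omega A v (e a) = 0.
Proof.
move=> [fz0 null iso]; split=> [[_ vnull viso]|[vnull viso]].
  split=> [|A a]; first by have [] := (vconsP v e (pfaffian_null z)).1 vnull.
  by have := viso A ord0 (lift ord0 a); rewrite vcons0 vcons_lift.
split=> // [|A]; first exact/vconsP.
apply/(vconsP v e (fun w => forall b, Omega A w (vcons v e b) = 0)); split=> [|a].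
  by apply/(vconsP v e (fun w => Omega A v w = 0)); split; [exact: Omegaxx|].
apply/(vconsP v e (fun w => Omega A (e a) w = 0)); split=> [|b]; last exact: iso.
by rewrite OmegaC viso oppr0.
Qed.

Lemma polarP z l (e : 'I_l -> V) v : lin_indep e -> integral_vectors z e ->
  polar F z e v <-> integral_vectors z (vcons v e).
Proof.
move=> e_free e_int; split=> [v_polar|ve_int phi phi_in]; last first.
  exact: inI_integral_vectors ve_int phi_in.
have [fz0 null iso] := e_int; have [w ew] := lin_indep_dual e_free.
have pair_det th : inI F z (wedge1 th (det_form w)) -> (forall a, th (e a) = 0) -> th v = 0.
  move=> /v_polar; rewrite -/(vcons v e) => + th0.
  by rewrite wedge1_vcons_vanish // det_form_dual // mulr1.
apply/integral_vectors_vcons => //; split.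
  split=> [A|A al]; apply: pair_det => [|a].
  - by apply: inI_eta; exact: altform_det_form.
  - by case: (null a).
  - by apply: inI_df; exact: altform_det_form.
  - by case: (null a).
case: l e v_polar iso w ew {e_free e_int fz0 null pair_det} => [|l] e v_polar iso w ew A.
  by case.
move=> a; have := v_polar _ (inI_Omega z A (altform_det_form (fun j => w (lift a j)))).
rewrite -/(vcons v e) Omega_wedge_vcons_isotropic // /wedge1 (bigD1 a) //= big1 ?addr0 => [|b ba].
  rewrite det_form_dual ?mulr1 => [/eqP|i j]; last by rewrite ew (inj_eq lift_inj).
  by rewrite mulf_eq0 signr_eq0 => /eqP.
have [i hi _] := unlift_some ba.
rewrite /det_form (expand_det_row _ i) big1 ?mulr0 // => j _.
by rewrite mxE -hi ew eq_sym (negbTE (neq_lift _ _)) mul0r.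
Qed.

End Ideal.

Section JetGraphs.
Variables (R : realType) (n m k : nat).
Variable F : 'I_m -> Gidx n k -> (FCoord n m k -> R) -> R.
Variable z : Coord n m -> R.
Hypothesis F_diff : rhs_differentiable F z.
Notation V := (Coord n m -> R).
Implicit Types (u v : V) (A B : 'I_m) (al be : Gidx n k) (L : Lidx n k)
  (q : 'I_m -> 'I_n -> 'I_n -> R) (c : 'I_n -> R).

Lemma OmegaE A u v : Omega A u v = dot (jpart u A) (xpart v) - dot (jpart v A) (xpart u).
Proof. by rewrite /Omega sumrB. Qed.

Lemma etaE A v : eta z A v = v (inl (inr A)) - dot (zpp z A) (xpart v).
Proof. by []. Qed.

Lemma xpart_vert W : xpart (vert W : V) = 0.
Proof. by []. Qed.

Lemma eta_vert A W : eta z A (vert W) = 0.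
Proof. by rewrite etaE xpart_vert linear0 subrr. Qed.

Lemma Omega_vert A W v : Omega A (vert W) v = dot (W A) (xpart v).
Proof. by rewrite OmegaE xpart_vert linear0 subr0. Qed.

Lemma basis_vec_inr (p : 'I_m * 'I_n) :
  basis_vec (inr p) = vert (fun A i => basis_vec p (A, i)) :> V.
Proof. by apply/funext => -[s|[A i]]. Qed.

Lemma Fproj_basis_vec_normal A al :
  Fproj (basis_vec (inr (A, val al)) : V) = 0 :> (FCoord n m k -> R).
Proof.
apply/funext => -[[i|B]|[B L]] //=; rewrite /zpp /basis_vec; case: eqP => [[_ Lal]|//].
have kal : (k <= val al)%N := valP al; have Lk : (val L < k)%N := valP L.
by move: kal; rewrite -[val al]Lal leqNgt Lk.
Qed.

Lemma jpart_basis_vec A B al be :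
  jpart (basis_vec (inr (A, val al))) B (val be) = ((B == A) && (be == al))%:R :> R.
Proof.
rewrite /jpart /basis_vec -[inr _ == _]/((B, val be) == (A, val al)) xpair_eqE val_eqE.
by case: (_ && _).
Qed.

Lemma df_basis_vec_normal A B al be :
  df F z B be (basis_vec (inr (A, val al))) = ((B == A) && (be == al))%:R.
Proof.
rewrite (df_gradient _ (F_diff B be)) Fproj_basis_vec_normal (linear0 (dot _)) subr0.
exact: jpart_basis_vec.
Qed.

Lemma eta_basis_vec A B : eta z B (basis_vec (inl (inr A))) = (B == A)%:R.
Proof.
rewrite etaE (_ : xpart _ = 0) ?(linear0 (dot _)) ?subr0 //.
by rewrite /basis_vec -[inl (inr B) == _]/(B == A); case: (_ == _).
Qed.

Lemma eta_is_scalar A : scalar (eta z A).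
Proof.
move=> a u v; rewrite !etaE (linearP (@xpart R n m)) (linearD (dot _)) (scalarZ (dot _)) /= !fctE.
by rewrite -[a *: _]/(a * _); ring.
Qed.

Lemma Omega_is_scalar A u : scalar (Omega A u).
Proof.
move=> a v w; rewrite !OmegaE (linearP (@xpart R n m)) (linearD (dot _)) (scalarZ (dot _)) /=.
by rewrite -[jpart (_ + w) A]/(a *: jpart v A + jpart w A) dotZDl; ring.
Qed.

Lemma jet_lift_null q c : prolongs F z q -> pfaffian_null F z (jet_lift z q c).
Proof. by move=> [_ qD]; split=> // A; rewrite etaE subrr. Qed.

Lemma Omega_jet_lift_r q A v c : symmetric_array (q A) ->
  Omega A v (jet_lift z q c) = dot (jpart v A - matvec (q A) (xpart v)) c.
Proof.
move=> qs; rewrite OmegaE [RHS]dotC (linearB (dot c)) /= dotC; congr (_ - _).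
by rewrite dotC dot_matvecC.
Qed.

Lemma Omega_jet_lift q A c c' : symmetric_array (q A) ->
  Omega A (jet_lift z q c) (jet_lift z q c') = 0.
Proof. by move=> qs; rewrite Omega_jet_lift_r // subrr dotC linear0. Qed.

Lemma vert_jet_defect q v : (forall A, eta z A v = 0) ->
  v = 1 *: vert (fun A => jpart v A - matvec (q A) (xpart v)) + jet_lift z q (xpart v).
Proof.
move=> eta0; rewrite scale1r; apply/funext => -[[i|A]|[A i]]; rewrite addrfctE /= ?add0r //.
  by have /eqP := eta0 A; rewrite etaE subr_eq0 => /eqP.
by rewrite !fctE subrK.
Qed.

Lemma eq_jet_lift Y q v : noncharacteristic F z Y -> prolongs F z q -> pfaffian_null F z v ->
  (forall A L, Omega A v (jet_lift z q (Y L)) = 0) -> v = jet_lift z q (xpart v).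
Proof.
move=> nonchar [qs qD] [eta0 df0] iso; rewrite {1}(vert_jet_defect q eta0).
rewrite (_ : vert _ = 0) ?scaler0 ?add0r //; apply/funext => -[//|[A i]] /=.
apply: (nonchar (fun A => jpart v A - matvec (q A) (xpart v))) => [B be|B L].
  have := df0 B be; rewrite {1}(vert_jet_defect q eta0) (df_is_scalar F_diff) qD.
  by rewrite mul1r addr0.
by rewrite -Omega_jet_lift_r.
Qed.

Section Frames.
Variables (l : nat) (kl : (k <= l)%N).

Definition frame_index (L : Lidx n k) : 'I_l := Ordinal (leq_trans (valP L) kl).

Definition frame_x (e : 'I_l -> V) (L : Lidx n k) := xpart (e (frame_index L)).

(* One jet containing [e_1, ..., e_k] exists; since [e_a] is isotropic with
   these, it lies in the same jet. *)
Lemma frame_in_jet (e : 'I_l -> V) : has_prolongations F z ->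
  noncharacteristic F z (frame_x e) -> (forall a, pfaffian_null F z (e a)) ->
  (forall A (a b : 'I_l), (b < k)%N -> (b < a)%N -> Omega A (e a) (e b) = 0) ->
  exists2 q, prolongs F z q & forall a, e a = jet_lift z q (xpart (e a)).
Proof.
move=> prolongable nonchar null iso.
have isoL A a L : Omega A (e a) (e (frame_index L)) = 0.
  have [h|h|h] := ltngtP (frame_index L) a; first by apply: iso => //; exact: valP L.
    by rewrite OmegaC iso ?oppr0 // (ltn_trans h (valP L)).
  by rewrite (_ : a = frame_index L) ?Omegaxx //; exact: val_inj.
pose N A L G := dot (jpart (e (frame_index L)) A) (frame_x e G).
have N_sym A : symmetric_array (N A).
  by move=> L G; apply/eqP; rewrite -subr_eq0 /N -OmegaE isoL.
have [q q_prol qN] := prolongs_prescribed F_diff prolongable nonchar N_sym.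
have [qs _] := q_prol.
have eL L : e (frame_index L) = jet_lift z q (frame_x e L).
  apply: (eq_jet_lift nonchar q_prol (null _)) => A G.
  rewrite Omega_jet_lift_r // dotC (linearB (dot _)) /= (qN A G L) N_sym dotC.
  by rewrite subrr.
exists q => // a; apply: (eq_jet_lift nonchar q_prol (null a)) => A L.
by rewrite -eL isoL.
Qed.

Lemma polar_jet (e : 'I_l -> V) : has_prolongations F z ->
  noncharacteristic F z (frame_x e) -> integral_element F z e ->
  exists q, forall v, polar F z e v <-> v = jet_lift z q (xpart v).
Proof.
move=> prolongable nonchar e_int; have e_vec := integral_element_vectors e_int.
have [fz0 null iso] := e_vec.
have [q q_prol eq] := frame_in_jet prolongable nonchar null (fun A a b _ _ => iso A a b).
have [qs _] := q_prol.
exists q => v; rewrite (polarP v (proj1 e_int) e_vec) integral_vectors_vcons //; split.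
  move=> [v_null v_iso]; apply: (eq_jet_lift nonchar q_prol v_null) => A L.
  by rewrite -eq v_iso.
move=> ->; split=> [|A a]; first exact: jet_lift_null.
by rewrite eq Omega_jet_lift.
Qed.

End Frames.

End JetGraphs.

Section Dimension.
Variable R : realType.

Lemma lin_indep_of_image (I J : finType) (f : {linear (I -> R) -> (J -> R)}) d
    (u : 'I_d -> I -> R) : lin_indep (fun j => f (u j)) -> lin_indep u.
Proof.
move=> fu_free lam lam_u; apply: fu_free => s.
have sumE (T : finType) (w : 'I_d -> T -> R) t : \sum_j lam j * w j t = (\sum_j lam j *: w j) t.
  by rewrite fct_sumE.
rewrite (sumE _ (fun j => f (u j))) (_ : \sum_j _ = f (\sum_j lam j *: u j)).
  rewrite (_ : \sum_j _ = 0) ?linear0 //.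
  by apply/funext => r; rewrite -sumE lam_u.
by rewrite linear_sum; apply: eq_bigr => j _; rewrite linearZZ.
Qed.

Variables (n m : nat).
Notation V := (Coord n m -> R).

Lemma same_dim_jets z z' q q' (H H' : V -> Prop) :
  (forall v, H v <-> v = jet_lift z q (xpart v)) ->
  (forall v, H' v <-> v = jet_lift z' q' (xpart v)) -> same_dim H H'.
Proof.
have transfer z1 q1 z2 q2 (H1 H2 : V -> Prop) d :
    (forall v, H1 v <-> v = jet_lift z1 q1 (xpart v)) ->
    (forall v, H2 v <-> v = jet_lift z2 q2 (xpart v)) -> has_indep H1 d -> has_indep H2 d.
  move=> H1E H2E [w [wH w_free]]; exists (fun j => jet_lift z2 q2 (xpart (w j))).
  split=> [j|]; first exact/H2E.
  apply: (@lin_indep_of_image _ _ (@xpart R n m)).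
  apply: (@lin_indep_of_image _ _ (jet_lift z1 q1)).
  rewrite (_ : (fun j => _) = w) //; apply/funext => j; exact/esym/H1E.
by move=> HE HE' d; split; apply: transfer.
Qed.

End Dimension.

Section Chart.
Variables (R : realType) (n m k l : nat).
Variable F : 'I_m -> Gidx n k -> (FCoord n m k -> R) -> R.
Notation V := (Coord n m -> R).
Notation chart := (XCoord n m l -> R).
Notation vertical := ('I_m + 'I_m * 'I_n)%type.
Implicit Types (t : chart) (w : V) (A B : 'I_m) (al be : Gidx n k) (a b c : 'I_l) (s : vertical).

Definition vcoord s : Coord n m :=
  match s with inl A => inl (inr A) | inr p => inr p end.

Lemma vcoord_inj : injective vcoord.
Proof. by case=> [A|p] [B|q] // [->]. Qed.

Definition fibre_coord a s : XCoord n m l :=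
  match s with inl A => inr (inl (inr (a, A))) | inr p => inr (inr (a, p)) end.

Lemma zof_fibre_shift t a s (e : R) : zof (t + e *: basis_vec (fibre_coord a s)) = zof t.
Proof. by case: s => s; apply/funext => i; rewrite /zof !fctE /basis_vec /= scaler0 addr0. Qed.

Lemma fibre_coord_eq a b r s :
  (fibre_coord a r == fibre_coord b s) = (a == b) && (r == s).
Proof. by case: r s => [A|p] [B|q]; rewrite ?andbF. Qed.

Lemma etilde_vcoord t a s : etilde t a (vcoord s) = t (fibre_coord a s).
Proof. by case: s => [A|[A i]]. Qed.

Lemma etilde_fibre_shift t a0 s (e : R) a :
  etilde (t + e *: basis_vec (fibre_coord a0 s)) a =
  (e * (a == a0)%:R) *: basis_vec (vcoord s) + etilde t a.
Proof.
have vertical_shift r : etilde (t + e *: basis_vec (fibre_coord a0 s)) a (vcoord r) =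
    ((e * (a == a0)%:R) *: basis_vec (vcoord s) + etilde t a) (vcoord r).
  rewrite etilde_vcoord !fctE etilde_vcoord addrC; congr (_ + _).
  rewrite -![_ *: _]/(_ * _) -mulrA; congr (_ * _).
  rewrite (basis_vec_inj _ _ _ vcoord_inj) /basis_vec fibre_coord_eq.
  by case: (a == a0); rewrite ?mul1r ?mul0r.
apply/funext => -[[i|A]|p]; [|exact: (vertical_shift (inl A))|exact: (vertical_shift (inr p))].
have vcoord_x : basis_vec (vcoord s) (inl (inl i)) = 0 :> R by case: s {vertical_shift}.
have fibre_coord_x (b : Bidx n l) : basis_vec (fibre_coord a0 s) (inr (inl (inl (a, b)))) = 0 :> R.
  by case: s {vertical_shift vcoord_x}.
rewrite [in RHS]addrfctE [in RHS]scalrfctE vcoord_x scaler0 add0r /=.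
by case: eqP => // _; case: insub => // b; rewrite addrfctE scalrfctE fibre_coord_x scaler0 addr0.
Qed.

Lemma vertical_expand w : xpart w = 0 -> w = \sum_s w (vcoord s) *: basis_vec (vcoord s).
Proof.
move=> w0.
have vertical r : w (vcoord r) = (\sum_s w (vcoord s) *: basis_vec (vcoord s)) (vcoord r).
  rewrite fct_sumE -[LHS](dot_basis (fun s => w (vcoord s)) r); apply: eq_bigr => s _.
  by rewrite fctE (basis_vec_inj _ _ _ vcoord_inj) /basis_vec eq_sym.
apply/funext => -[[i|A]|p]; [|exact: (vertical (inl A))|exact: (vertical (inr p))].
rewrite fct_sumE big1 => [|s _]; first exact: (congr1 (@^~ i) w0).
by case: s => s; rewrite fctE /basis_vec /= scaler0.
Qed.

(* The derivative at [t] of a function of the family when [e_a0] moves in the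
   vertical direction [w]. *)
Definition fibre_variation t a0 w (i : FamIdx n m k l) : R := match i with
  | inl (inl _) => 0
  | inl (inr (A, a)) => (a == a0)%:R * eta (zof t) A w
  | inr (inl ((A, al), a)) => (a == a0)%:R * df F (zof t) A al w
  | inr (inr ((A, a), b)) =>
      (a == a0)%:R * Omega A w (etilde t b) + (b == a0)%:R * Omega A (etilde t a) w
  end.

Section AtChartPoint.
Variable t : chart.
Hypothesis F_diff : rhs_differentiable F (zof t).

Lemma pderiv_fam_fibre a s i :
  pderiv (fam F i) (fibre_coord a s) t = fibre_variation t a (basis_vec (vcoord s)) i.
Proof.
apply: pderiv_affine => e; case: i => [[[A al]|[A b]]|[[[A al] b]|[[A b] b']]] /=.
- by rewrite zof_fibre_shift mulr0 add0r.
- by rewrite zof_fibre_shift etilde_fibre_shift eta_is_scalar mulrA.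
- by rewrite zof_fibre_shift etilde_fibre_shift (df_is_scalar F_diff) mulrA.
rewrite !etilde_fibre_shift Omega_is_scalar.
rewrite !(OmegaC A (_ + _)) !Omega_is_scalar Omegaxx.
rewrite (OmegaC A (etilde t b') (etilde t b)) (OmegaC A (etilde t b') (basis_vec _)).
by rewrite (OmegaC A (basis_vec _) (etilde t b)); ring.
Qed.

Lemma fibre_variation_is_scalar a i : scalar (fibre_variation t a ^~ i).
Proof.
move=> x v w; case: i => [[[A al]|[A b]]|[[[A al] b]|[[A b] b']]] /=.
- by rewrite mulr0 addr0.
- by rewrite eta_is_scalar; ring.
- by rewrite (df_is_scalar F_diff); ring.
rewrite !(OmegaC A _ (etilde t b')) !Omega_is_scalar; ring.
Qed.

Lemma pderiv_fz_p A B al be : pderiv (fam F (inl (inl (B, be)))) (inl (inr (A, val al))) t =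
  ((B == A) && (be == al))%:R.
Proof.
apply: pderiv_affine => e /=.
have -> : zof (t + e *: basis_vec (inl (inr (A, val al)))) =
    zof t + e *: basis_vec (inr (A, val al)).
  by apply/funext => r; rewrite /zof !fctE (basis_vec_inj _ _ _ inl_inj).
rewrite /fz (linearD (@Fproj R n m k)) (linearZZ (@Fproj R n m k)) /= Fproj_basis_vec_normal.
rewrite scaler0 addr0 -(jpart_basis_vec R A B al be) /zpp !fctE /jpart -[_ *: _]/(_ * _); ring.
Qed.

Variable kl : (k <= l)%N.

Definition independent_eqs : {set FamIdx n m k l} :=
  [set i : FamIdx n m k l | match i with
   | inr (inr (_, a, b)) => (b < k)%N && (b < a)%N
   | _ => true end].

Section Relation.
Variable mu : FamIdx n m k l -> R.
Hypothesis F_noncharacteristic : noncharacteristic F (zof t) (frame_x kl (etilde t)).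
Hypothesis kn : (k < n)%N.
Hypothesis relation : forall tau, \sum_(i in independent_eqs) mu i * pderiv (fam F i) tau t = 0.

Lemma relation_variation a w : xpart w = 0 ->
  \sum_(i in independent_eqs) mu i * fibre_variation t a w i = 0.
Proof.
move=> /vertical_expand ->.
under eq_bigr => i _ do rewrite (scalar_sum _ _ (fibre_variation_is_scalar a i)) mulr_sumr.
rewrite exchange_big big1 // => s _ /=.
under eq_bigr => i _ do rewrite mulrCA -pderiv_fam_fibre.
by rewrite -mulr_sumr relation mulr0.
Qed.

Lemma relation_coef0 i0 (X : FamIdx n m k l -> R) :
  \sum_(i in independent_eqs) mu i * X i = 0 -> i0 \in independent_eqs -> X i0 = 1 ->
  (forall i, i \in independent_eqs -> i != i0 -> mu i = 0 \/ X i = 0) -> mu i0 = 0.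
Proof.
move=> sum0 i0_in X1 X0; rewrite -[RHS]sum0 (bigD1 i0) //= X1 mulr1.
rewrite big1 ?addr0 // => i /andP[i_in i_ne].
by case: (X0 i i_in i_ne) => ->; rewrite ?mul0r ?mulr0.
Qed.

(* Descending induction on [a]: moving [e_a] along a symbol direction also
   changes [Omega(e_a', e_a)] for [a' > a], whose coefficients vanish already. *)
Lemma relation_Omega0 A a b : (b < k)%N -> (b < a)%N -> mu (inr (inr (A, a, b))) = 0.
Proof.
have [d] := ubnP (l - a); elim: d A a b => // d IH A a b a_d bk ba.
pose L0 : Lidx n k := exist _ (Ordinal (ltn_trans bk kn)) bk.
have [W W_symbol WY] := in_symbol_prescribed F_diff
  (fun B L => ((B == A) && (L == L0))%:R) F_noncharacteristic.
have W_dot B (c : 'I_l) : (c < k)%N -> dot (W B) (xpart (etilde t c)) = ((B == A) && (c == b))%:R.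
  move=> ck; have := WY B (exist _ (Ordinal (ltn_trans ck kn)) ck).
  rewrite /frame_x (_ : frame_index _ _ = c); last exact: val_inj.
  by move=> ->; rewrite -!val_eqE.
apply: (relation_coef0 (relation_variation a (xpart_vert W))) => /=.
- by rewrite inE bk.
- rewrite eqxx Omega_vert W_dot // !eqxx (_ : (b == a) = false) ?mul0r ?addr0 ?mulr1 //.
  by apply/negbTE; rewrite -val_eqE neq_ltn ba.
case=> [[[B al]|[B c]]|[[[B al] c]|[[B c] c']]] i_in i_ne /=; [by right|right|right|].
- by rewrite eta_vert mulr0.
- by rewrite W_symbol mulr0.
move: i_in; rewrite inE => /andP[c'k c'c].
have [c'a|_] := eqVneq c' a; [left|right; rewrite mul0r addr0].
  by apply: IH => //; have := ltn_ord c; rewrite c'a in c'c; lia.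
have [ca|_] := eqVneq c a; last by rewrite mul0r.
rewrite Omega_vert W_dot // mul1r; case: eqP => [BA|//]; case: eqP => [cb|//].
by rewrite ca BA cb eqxx in i_ne.
Qed.

Lemma relation_df0 A al a : mu (inr (inl (A, al, a))) = 0.
Proof.
have x0 : xpart (basis_vec (inr (A, val al)) : V) = 0 by rewrite basis_vec_inr xpart_vert.
apply: (relation_coef0 (relation_variation a x0)) => /=; first by rewrite inE.
  by rewrite (df_basis_vec_normal F_diff) !eqxx mulr1.
case=> [[[B be]|[B c]]|[[[B be] c]|[[B c] c']]] i_in i_ne /=; [by right|right|right|left].
- by rewrite basis_vec_inr eta_vert mulr0.
- rewrite (df_basis_vec_normal F_diff).
  case: eqP => [ca|_]; last by rewrite mul0r.
  case: eqP => [BA|_]; case: eqP => [beal|_]; rewrite ?mulr0 //.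
  by rewrite ca BA beal eqxx in i_ne.
- by move: i_in; rewrite inE => /andP[]; exact: relation_Omega0.
Qed.

Lemma relation_eta0 A a : mu (inl (inr (A, a))) = 0.
Proof.
have x0 : xpart (basis_vec (inl (inr A)) : V) = 0 by [].
apply: (relation_coef0 (relation_variation a x0)) => /=; first by rewrite inE.
  by rewrite eta_basis_vec !eqxx mulr1.
case=> [[[B be]|[B c]]|[[[B be] c]|[[B c] c']]] i_in i_ne /=; [by right|right|left|left].
- rewrite eta_basis_vec; case: eqP => [ca|_]; case: eqP => [BA|_]; rewrite ?mulr0 ?mul0r //.
  by rewrite ca BA eqxx in i_ne.
- exact: relation_df0.
- by move: i_in; rewrite inE => /andP[]; exact: relation_Omega0.
Qed.

Lemma relation_fz0 A al : mu (inl (inl (A, al))) = 0.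
Proof.
apply: (relation_coef0 (relation (inl (inr (A, val al))))); first by rewrite inE.
  by rewrite pderiv_fz_p !eqxx.
case=> [[[B be]|[B c]]|[[[B be] c]|[[B c] c']]] i_in i_ne; [right|left|left|left].
- rewrite pderiv_fz_p; case: eqP => [BA|//]; case: eqP => [beal|//].
  by rewrite BA beal eqxx in i_ne.
- exact: relation_eta0.
- exact: relation_df0.
- by move: i_in; rewrite inE => /andP[]; exact: relation_Omega0.
Qed.

Lemma relation_trivial i : i \in independent_eqs -> mu i = 0.
Proof.
case: i => [[[A al]|[A a]]|[[[A al] a]|[[A a] b]]] i_in.
- exact: relation_fz0.
- exact: relation_eta0.
- exact: relation_df0.
- by move: i_in; rewrite inE => /andP[]; exact: relation_Omega0.
Qed.

End Relation.
End AtChartPoint.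

Lemma famP t : (forall i, fam F i t = 0) <-> integral_vectors F (zof t) (etilde t).
Proof.
split=> [fam0|[fz0 null iso]].
  split=> [A al|a|A a b]; first exact: (fam0 (inl (inl (A, al)))).
    by split=> [A|A al]; [exact: (fam0 (inl (inr (A, a))))|exact: (fam0 (inr (inl (A, al, a))))].
  exact: (fam0 (inr (inr (A, a, b)))).
by case=> [[[A al]|[A a]]|[[[A al] a]|[[A a] b]]] //=; case: (null a).
Qed.

Section Regularity.
Hypotheses (kl : (k <= l)%N) (kn : (k < n)%N).
Variable U : (FCoord n m k -> R) -> Prop.
Hypothesis F_analytic : forall A al, real_analytic_on U (F A al).
Hypothesis solvable : forall w : FCoord n m k -> R, U w ->
  approx_solvable F (fun i => w (inl (inl i))) (fun B => w (inl (inr B)))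
                    (fun B L => w (inr (B, L))).

Definition admissible t :=
  U (Fproj (zof t)) /\ noncharacteristic F (zof t) (frame_x kl (etilde t)).

Lemma admissible_differentiable t : admissible t -> rhs_differentiable F (zof t).
Proof. by move=> [Ut _] A al; exact: analytic_has_gradient (proj2 (F_analytic A al) _ Ut). Qed.

Lemma admissible_prolongations t : admissible t -> (forall A al, fz F A al (zof t) = 0) ->
  has_prolongations F (zof t).
Proof.
move=> [Ut _] fz0; apply: (@approx_solvable_prolongations _ _ _ _ _ _ U) => // [A al|].
  exact: (proj2 (F_analytic A al) _ Ut).
exact: solvable Ut.
Qed.

Lemma independent_eqs_sufficient t : admissible t ->
  (forall i, i \in independent_eqs -> fam F i t = 0) -> forall i, fam F i t = 0.
Proof.
move=> t_adm fam0.
have fz0 A al : fz F A al (zof t) = 0 by apply: (fam0 (inl (inl (A, al)))); rewrite inE.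
have null a : pfaffian_null F (zof t) (etilde t a).
  split=> [A|A al]; first by apply: (fam0 (inl (inr (A, a)))); rewrite inE.
  by apply: (fam0 (inr (inl (A, al, a)))); rewrite inE.
have iso A (a b : 'I_l) : (b < k)%N -> (b < a)%N -> Omega A (etilde t a) (etilde t b) = 0.
  by move=> bk ba; apply: (fam0 (inr (inr (A, a, b)))); rewrite inE bk.
have [q [qs _] eq] := frame_in_jet (admissible_differentiable t_adm)
  (admissible_prolongations t_adm fz0) (proj2 t_adm) null iso.
by apply/famP; split=> // A a b; rewrite (eq a) (eq b) Omega_jet_lift.
Qed.

Lemma admissible_ordinary t : (\forall t' \near dmax_nbhs t, admissible t') ->
  integral_element F (zof t) (etilde t) -> kahler_ordinary F t.
Proof.
move=> adm t_int; have t_adm := dmax_nbhs_center adm.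
split=> //; split; first by apply/famP; exact: integral_element_vectors.
exists independent_eqs; split=> [mu relation i|].
  exact: (relation_trivial (admissible_differentiable t_adm) (proj2 t_adm) kn).
have [r r0 adm_r] := adm; exists r; split=> // t' /adm_r t'_adm.
by split=> [fam0 i _|]; [exact: fam0|exact: independent_eqs_sufficient].
Qed.

Lemma admissible_polar t : admissible t -> integral_element F (zof t) (etilde t) ->
  exists q, forall v, polar F (zof t) (etilde t) v <-> v = jet_lift (zof t) q (xpart v).
Proof.
move=> t_adm t_int; have [fz0 _ _] := integral_element_vectors t_int.
exact: (polar_jet (admissible_differentiable t_adm)
  (admissible_prolongations t_adm fz0) (proj2 t_adm)).
Qed.

Lemma admissible_regular t : (\forall t' \near dmax_nbhs t, admissible t') ->
  integral_element F (zof t) (etilde t) -> kahler_regular F t.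
Proof.
move=> adm t_int; split; first exact: admissible_ordinary.
have [q polarE] := admissible_polar (dmax_nbhs_center adm) t_int.
have [r r0 adm_r] := adm; exists r; split=> // t' /adm_r t'_adm t'_int.
have [q' polarE'] := admissible_polar t'_adm t'_int.
exact: same_dim_jets polarE' polarE.
Qed.

Lemma pderiv_F_bounded (w : FCoord n m k -> R) : U w -> exists2 C, 0 <= C &
  \forall w' \near dmax_nbhs w, forall A al i, `|pderiv (F A al) i w'| <= C.
Proof.
move=> Uw; have /choice [C hC] : forall p : 'I_m * Gidx n k, exists C,
    \forall w' \near dmax_nbhs w, forall i, `|pderiv (F p.1 p.2) i w'| <= C.
  by move=> p; exact: real_analytic_pderiv_bounded (F_analytic p.1 p.2) Uw.
exists (\sum_p `|C p|); first exact: sumr_ge0.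
have : \forall w' \near dmax_nbhs w, forall p i, `|pderiv (F p.1 p.2) i w'| <= C p.
  exact: filter_forall.
apply: filterS => w' hw A al i; apply: le_trans (hw (A, al) i) (le_trans (ler_norm _) _).
by rewrite (bigD1 (A, al)) //= lerDl sumr_ge0.
Qed.

Lemma dmax_Fproj t t' : dmax (Fproj (zof t')) (Fproj (zof t) : FCoord n m k -> R) <= dmax t' t.
Proof.
apply: dmax_le => [|[[i|B]|[B L]]]; first exact: dmax_ge0.
- exact: (le_dmax t' t (inl (inl (inl i)))).
- exact: (le_dmax t' t (inl (inl (inr B)))).
- exact: (le_dmax t' t (inl (inr (B, val L)))).
Qed.

Lemma dmax_frame_x t t0 L : (forall a (b : Bidx n l), t0 (inr (inl (inl (a, b)))) = 0) ->
  dmax (frame_x kl (etilde t) L) (basis_vec (val L)) <= dmax t t0.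
Proof.
move=> t0_x; apply: dmax_le => [|i]; first exact: dmax_ge0.
rewrite /frame_x /xpart /basis_vec /= -val_eqE /=; case: eqP => _.
  by rewrite subrr normr0 dmax_ge0.
rewrite subr0; case: insubP => [b _ _|_]; last by rewrite normr0 dmax_ge0.
by have := le_dmax t t0 (inr (inl (inl (frame_index kl L, b)))); rewrite t0_x subr0.
Qed.

Lemma near_admissible t0 : U (Fproj (zof t0)) ->
  (forall a (b : Bidx n l), t0 (inr (inl (inl (a, b)))) = 0) ->
  open_set U -> \forall t \near dmax_nbhs t0, admissible t.
Proof.
move=> Ut0 t0_x U_open.
have Fproj_cvg (P : set (FCoord n m k -> R)) :
    dmax_nbhs (Fproj (zof t0)) P -> \forall t \near dmax_nbhs t0, P (Fproj (zof t)).
  by move=> [r r0 hP]; exists r => // t tr; apply: hP; exact: le_lt_trans (dmax_Fproj t0 t) tr.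
have [C C0 F_le] := pderiv_F_bounded Ut0.
have U_near : dmax_nbhs (Fproj (zof t0)) U by have [r [r0 hr]] := U_open _ Ut0; exists r.
set K : R := (#|{: 'I_m * Lidx n k}|)%:R * (n%:R * (1 + C)).
have K0 : 0 <= K by rewrite !mulr_ge0 // addr_ge0.
have K1 : 0 < K + 1 by rewrite ltr_wpDl.
have eK : 0 < (K + 1)^-1 by rewrite invr_gt0.
apply: filterS3 (Fproj_cvg _ U_near) (Fproj_cvg _ F_le) (near_dmax_lt t0 eK) => t Ut Ft tK.
have F_diff : rhs_differentiable F (zof t).
  by move=> A al; exact: analytic_has_gradient (proj2 (F_analytic A al) _ Ut).
split=> //; apply: (noncharacteristic_near_basis F_diff C0 (dmax_ge0 t t0)).
- by move=> A al s; exact: Ft.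
- by move=> L; exact: dmax_frame_x.
apply: le_lt_trans (ler_wpM2l K0 (ltW tK)) _.
by rewrite ltr_pdivrMr // mul1r ltrDl.
Qed.

End Regularity.
End Chart.

Theorem theorem6p1 (R : realType) (n m k l : nat)
  (hk : (0 < k)%N) (hkn : (k < n)%N) (hm : (0 < m)%N)
  (U : (FCoord n m k -> R) -> Prop)
  (F : 'I_m -> Gidx n k -> (FCoord n m k -> R) -> R)
  (hF : forall A al, real_analytic_on U (F A al))
  (hsolv : forall w : FCoord n m k -> R, U w ->
     approx_solvable F (fun i => w (inl (inl i))) (fun B => w (inl (inr B)))
                       (fun B L => w (inr (B, L))))
  (hkl : (k <= l)%N)
  (z0 : Coord n m -> R)
  (hz0U : U (Fproj z0))
  (hz0F : forall A (al : Gidx n k), zpp z0 A (val al) = F A al (Fproj z0))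
  (c0 : ChartC n m l -> R)
  (hc0 : forall a b, c0 (inl (inl (a, b))) = 0)
  (hE0 : integral_element F (zof (fun s => match s with
                                           | inl s' => z0 s'
                                           | inr s' => c0 s' end))
                            (etilde (fun s => match s with
                                              | inl s' => z0 s'
                                              | inr s' => c0 s' end))) :
  exists r : R, 0 < r /\
    forall t : XCoord n m l -> R,
      dmax t (fun s => match s with inl s' => z0 s' | inr s' => c0 s' end) < r ->
      integral_element F (zof t) (etilde t) ->
      kahler_regular F t.
Proof.
have U_open : open_set U := proj1 (hF (Ordinal hm) (exist _ (Ordinal hkn) (leqnn k))).
set t0 := (fun s => match s with inl s' => z0 s' | inr s' => c0 s' end).
have [r r0 near_r] := dmax_nbhs_nbhs (near_admissible hkl hF (t0 := t0) hz0U hc0 U_open).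
exists r; split=> // t /near_r t_adm; exact: (admissible_regular hkn hF hsolv t_adm).
Qed.
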